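(* The lattice of coideal subalgebras of $KD(4)$ (dimension $16$) consists of $\mathbb{C}$, $KD(4)$ and exactly the following coideal subalgebras, given by their Jones projections: Dimension $2$: $I_0$: $e_1+e_2+e_3+e_4+q_1+q_2$; $I_1$: $e_1+e_4+q_1+p_2$; $I_2$: $e_1+e_4+q_1+p_1$; $I_3$: $e_1+e_2+e_3+e_4+r^1_{2,2}+r^3_{1,1}$; $I_4$: $e_1+e_2+e_3+e_4+r^1_{1,1}+r^3_{2,2}$. Dimension $4$: $J_0$: $e_1+e_4+q_1$; $J_2$: $e_1+e_4+q_2$; $J_1$: $e_1+e_3+r^2_{1,1}$; $J_3$: $e_1+e_3+r^2_{2,2}$; $J_{20}$: $e_1+e_2+e_3+e_4$; $J_{21}$: $e_1+e_2+r^1_{1,1}$; $J_{22}$: $e_1+e_2+r^1_{2,2}$; $J_{23}$: $e_1+e_2+r^3_{2,2}$; $J_{24}$: $e_1+e_2+r^3_{1,1}$. Dimension $8$: $K_2$: $e_1+e_2$; $K_3$: $e_1+e_3$; $K_4$: $e_1+e_4$. The order of the lattice is inclusion, and $I\subset I'$ if and only if $p_{I'}\le p_I$.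
   Context: A coideal subalgebra of a finite-dimensional Kac algebra ($C^*$-Hopf algebra) $K$ is a unital $*$-subalgebra $I$ with $\Delta(I)\subset K\otimes I$. Its Jones projection $p_I$ is the unique nonzero projection in $I$ with $yp_I=\varepsilon(y)p_I$ for all $y\in I$; $I$ is generated by $p_I$ as a coideal subalgebra. $KD(n)$ ($n\ge1$): let $D_{2n}=\langle a,b\mid a^{2n}=b^2=1,\ ba=a^{-1}b\rangle$ (order $4n$), with canonical basis $\lambda(g)$ of $\mathbb{C}[D_{2n}]$, and $\Delta_s(\lambda(g))=\lambda(g)\otimes\lambda(g)$. Put $h_1=1,h_2=a^n,h_3=b,h_4=ba^n$, $\nu=-1+2\mathrm{i}$, and $\Omega=\sum_{i,j}c_{i,j}\lambda(h_i)\otimes\lambda(h_j)$ with $$(c_{i,j})=\frac18\begin{pmatrix}5&1&1&1\\1&1&\bar\nu&\nu\\1&\nu&1&\bar\nu\\1&\bar\nu&\nu&1\end{pmatrix}.$$ $\Omega$ is unitary. $KD(n)$ is the $*$-algebra $\mathbb{C}[D_{2n}]$ with its usual counit and antipode and the coproduct $\Delta(x)=\Omega\Delta_s(x)\Omega^*$. Elements (here $n=4$): with $\epsilon=\mathrm{e}^{\mathrm{i}\pi/n}$, sums over $k=0,\dots,2n-1$, and $1\le j\le n-1$: $e_1=\frac1{4n}\sum(\lambda(a^k)+\lambda(ba^k))$, $e_2=\frac1{4n}\sum(\lambda(a^k)-\lambda(ba^k))$, $e_3=\frac1{4n}\sum(-1)^k(\lambda(a^k)-\lambda(ba^k))$,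 $e_4=\frac1{4n}\sum(-1)^k(\lambda(a^k)+\lambda(ba^k))$, $e^j_{1,1}=\frac1{2n}\sum\epsilon^{-jk}\lambda(a^k)$, $e^j_{2,2}=\frac1{2n}\sum\epsilon^{jk}\lambda(a^k)$, $e^j_{1,2}=\frac1{2n}\sum\epsilon^{jk}\lambda(ba^k)$, $e^j_{2,1}=\frac1{2n}\sum\epsilon^{-jk}\lambda(ba^k)$. Put $r^j_{1,1}=\frac12(e^j_{1,1}-\mathrm{i}e^j_{1,2}+\mathrm{i}e^j_{2,1}+e^j_{2,2})$, $r^j_{2,2}=\frac12(e^j_{1,1}+\mathrm{i}e^j_{1,2}-\mathrm{i}e^j_{2,1}+e^j_{2,2})$, $p^j_{1,1}=\frac12(e^j_{1,1}+e^j_{1,2}+e^j_{2,1}+e^j_{2,2})$, $p^j_{2,2}=\frac12(e^j_{1,1}-e^j_{1,2}-e^j_{2,1}+e^j_{2,2})$. For $i=1,2$: $p_i=\sum_{j\text{ odd},1\le j\le n-1}p^j_{i,i}$, $q_i=\sum_{j\text{ even},1\le j\le n-1}p^j_{i,i}$. *)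

(* Defs.v *)
From HB Require Import structures.
From mathcomp Require Import all_boot all_order all_fingroup all_algebra.
From mathcomp Require Import reals trigo complex.

Set Implicit Arguments.
Unset Strict Implicit.
Unset Printing Implicit Defensive.

Import Order.TTheory GRing.Theory Num.Theory.
Local Open Scope ring_scope.

(* The group algebra C[G]: the functions G -> C with the convolution product.
   {ffun gT -> C^o} is hidden behind a new name because it already carries a
   pointwise ring structure. *)
Definition group_algebra (C : fieldType) (gT : finGroupType) : Type :=
  {ffun gT -> C^o}.

HB.instance Definition _ (C : fieldType) (gT : finGroupType) :=
  Vector.copy (group_algebra C gT) {ffun gT -> C^o}.

Section GroupAlgebra.
Variables (C : fieldType) (gT : finGroupType).
Local Notation A := (group_algebra C gT).
Implicit Types (x y z : A) (g h : gT).

Definition gcoef x g : C := (x : {ffun gT -> C^o}) g.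

Definition gmk (f : gT -> C) : A := [ffun g => f g : C^o].

Definition lambda g : A := gmk (fun h => (h == g)%:R).

Definition gmul x y : A :=
  gmk (fun g => \sum_h gcoef x h * gcoef y (h^-1 * g)%g).

Lemma gcoefE f g : gcoef (gmk f) g = f g.
Proof. by rewrite /gcoef ffunE. Qed.

Lemma gcoefP x y : (forall g, gcoef x g = gcoef y g) -> x = y.
Proof. by move=> eqxy; apply/ffunP. Qed.

Lemma gcoefD x y g : gcoef (x + y) g = gcoef x g + gcoef y g.
Proof. exact: ffunE. Qed.

Lemma gcoefZ (k : C) x g : gcoef (k *: x) g = k * gcoef x g.
Proof. exact: ffunE. Qed.

Lemma gcoef0 g : gcoef 0 g = 0.
Proof. exact: ffunE. Qed.

Lemma gmulA : associative gmul.
Proof.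
move=> x y z; apply: gcoefP => g; rewrite !gcoefE.
under eq_bigr => h _ do rewrite gcoefE mulr_sumr.
under [RHS]eq_bigr => h _ do rewrite gcoefE mulr_suml.
rewrite [RHS]exchange_big /=; apply: eq_bigr => h _.
rewrite [RHS](reindex_inj (mulgI h)) /=; apply: eq_bigr => k _.
by rewrite mulKg invMg mulrA -mulgA.
Qed.

Lemma gmul1 : left_id (lambda 1) gmul.
Proof.
move=> x; apply: gcoefP => g; rewrite gcoefE (bigD1 1%g) //= big1.
  by rewrite gcoefE eqxx mul1r addr0 invg1 mul1g.
by move=> h /negbTE h1; rewrite gcoefE h1 mul0r.
Qed.

Lemma gmulr1 : right_id (lambda 1) gmul.
Proof.
move=> x; apply: gcoefP => g; rewrite gcoefE (bigD1 g) //= big1.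
  by rewrite gcoefE mulVg eqxx mulr1 addr0.
move=> h hg; rewrite gcoefE (_ : _ == _ = false) ?mulr0 //.
by rewrite -eq_mulVg1 (negbTE hg).
Qed.

Lemma gmulDl : left_distributive gmul +%R.
Proof.
move=> x y z; apply: gcoefP => g; rewrite gcoefD !gcoefE -big_split /=.
by apply: eq_bigr => h _; rewrite gcoefD mulrDl.
Qed.

Lemma gmulDr : right_distributive gmul +%R.
Proof.
move=> x y z; apply: gcoefP => g; rewrite gcoefD !gcoefE -big_split /=.
by apply: eq_bigr => h _; rewrite gcoefD mulrDr.
Qed.

Lemma lambda1_neq0 : lambda 1 != 0.
Proof.
apply/eqP => /(congr1 (gcoef^~ 1%g)).
by rewrite gcoefE gcoef0 eqxx => /eqP; rewrite oner_eq0.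
Qed.

HB.instance Definition _ := GRing.Zmodule_isNzRing.Build A
  gmulA gmul1 gmulr1 gmulDl gmulDr lambda1_neq0.

Lemma gscalerAl (k : C) x y : k *: (x * y) = (k *: x) * y.
Proof.
apply: gcoefP => g; rewrite gcoefZ !gcoefE mulr_sumr.
by apply: eq_bigr => h _; rewrite gcoefZ mulrA.
Qed.

HB.instance Definition _ := GRing.Lmodule_isLalgebra.Build C A gscalerAl.

Lemma gscalerAr (k : C) x y : k *: (x * y) = x * (k *: y).
Proof.
apply: gcoefP => g; rewrite gcoefZ !gcoefE mulr_sumr.
by apply: eq_bigr => h _; rewrite gcoefZ mulrCA.
Qed.

HB.instance Definition _ := GRing.Lalgebra_isAlgebra.Build C A gscalerAr.

Definition counit x : C := \sum_g gcoef x g.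

End GroupAlgebra.

Section Tensor.
Variables (C : fieldType) (gT : finGroupType).
Local Notation A := (group_algebra C gT).

(* C[G] (x) C[G] is identified with C[G x G] through
   lambda(g) (x) lambda(h) = lambda((g, h)). *)
Definition gtensor (x y : A) : group_algebra C (gT * gT)%type :=
  gmk (fun u : gT * gT => gcoef x u.1 * gcoef y u.2).

Definition tensorv (U V : {vspace A}) : {vspace group_algebra C (gT * gT)%type} :=
  <<[seq gtensor x y | x <- vbasis U, y <- vbasis V]>>%VS.

Definition group_coproduct (x : A) : group_algebra C (gT * gT)%type :=
  \sum_g gcoef x g *: gtensor (lambda C g) (lambda C g).

End Tensor.

Section StarAlgebra.
Variables (C : numClosedFieldType) (gT : finGroupType).
Local Notation A := (group_algebra C gT).

Definition gstar (x : A) : A := gmk (fun g => (gcoef x g^-1%g)^*).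

Definition is_projection (p : A) : Prop := gstar p = p /\ p * p = p.

(* The order of the C*-algebra C[G], in which positive means of the form z^* z. *)
Definition cstar_le (x y : A) : Prop := exists z : A, y - x = gstar z * z.

Definition coideal_subalgebra
    (Delta : A -> group_algebra C (gT * gT)%type) (I : {vspace A}) : Prop :=
  [/\ 1 \in I,
      {in I &, forall x y, x * y \in I},
      {in I, forall x, gstar x \in I}
    & {in I, forall x, Delta x \in tensorv fullv I}].

Definition jones_projection (I : {vspace A}) (p : A) : Prop :=
  unique (fun q => [/\ q \in I, is_projection q, q != 0
                     & {in I, forall y, y * q = counit y *: q}]) p.

End StarAlgebra.

(* gT is a dihedral group of order 4n, with chosen generators a and b. The
   relations present a group of order 4n, so the order condition says that no
   other relation holds ('D_(4 * n) has such generators whenever 0 < n). *)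
Definition dihedral_generators (n : nat) (gT : finGroupType) (a b : gT) : Prop :=
  [/\ <<[set a; b]>>%g = [set: gT],
      (a ^+ (2 * n) = 1)%g, (b ^+ 2 = 1)%g, (b * a = a^-1 * b)%g
    & #|gT| = (4 * n)%N].

Section KD.
Variables (R : realType) (n : nat) (gT : finGroupType) (a b : gT).
Local Notation C := R[i].
Local Notation A := (group_algebra C gT).

Definition Omega_group : seq gT := [:: 1; a ^+ n; b; b * a ^+ n]%g.

Definition nu : C := -1 + 2 * 'i.

Definition Omega_coef : seq (seq C) :=
  [:: [:: 5; 1;    1;    1   ];
      [:: 1; 1;    nu^*; nu  ];
      [:: 1; nu;   1;    nu^*];
      [:: 1; nu^*; nu;   1   ]].

Definition Omega : group_algebra C (gT * gT)%type :=
  \sum_(i < 4) \sum_(j < 4)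
    (8^-1 * (nth [::] Omega_coef i)`_j) *:
      gtensor (lambda C (nth 1%g Omega_group i))
              (lambda C (nth 1%g Omega_group j)).

Definition KD_coproduct (x : A) : group_algebra C (gT * gT)%type :=
  Omega * group_coproduct x * gstar Omega.

Definition epsilon : C := (cos (pi / n%:R) +i* sin (pi / n%:R))%C.

Local Notation la k := (lambda C (a ^+ k)%g).
Local Notation lba k := (lambda C (b * a ^+ k)%g).

Definition e1 : A := (4 * n)%:R^-1 *: \sum_(k < 2 * n) (la k + lba k).
Definition e2 : A := (4 * n)%:R^-1 *: \sum_(k < 2 * n) (la k - lba k).
Definition e3 : A :=
  (4 * n)%:R^-1 *: \sum_(k < 2 * n) (-1) ^+ k *: (la k - lba k).
Definition e4 : A :=
  (4 * n)%:R^-1 *: \sum_(k < 2 * n) (-1) ^+ k *: (la k + lba k).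

Definition e11 (j : nat) : A :=
  (2 * n)%:R^-1 *: \sum_(k < 2 * n) epsilon ^- (j * k) *: la k.
Definition e22 (j : nat) : A :=
  (2 * n)%:R^-1 *: \sum_(k < 2 * n) epsilon ^+ (j * k) *: la k.
Definition e12 (j : nat) : A :=
  (2 * n)%:R^-1 *: \sum_(k < 2 * n) epsilon ^+ (j * k) *: lba k.
Definition e21 (j : nat) : A :=
  (2 * n)%:R^-1 *: \sum_(k < 2 * n) epsilon ^- (j * k) *: lba k.

Definition r11 (j : nat) : A :=
  2^-1 *: (e11 j - 'i *: e12 j + 'i *: e21 j + e22 j).
Definition r22 (j : nat) : A :=
  2^-1 *: (e11 j + 'i *: e12 j - 'i *: e21 j + e22 j).
Definition p11 (j : nat) : A := 2^-1 *: (e11 j + e12 j + e21 j + e22 j).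
Definition p22 (j : nat) : A := 2^-1 *: (e11 j - e12 j - e21 j + e22 j).

Definition p1 : A := \sum_(1 <= j < n | odd j) p11 j.
Definition p2 : A := \sum_(1 <= j < n | odd j) p22 j.
Definition q1 : A := \sum_(1 <= j < n | ~~ odd j) p11 j.
Definition q2 : A := \sum_(1 <= j < n | ~~ odd j) p22 j.

End KD.

Inductive KD4_label : Type :=
  | I0 | I1 | I2 | I3 | I4
  | J0 | J2 | J1 | J3 | J20 | J21 | J22 | J23 | J24
  | K2 | K3 | K4.

Definition KD4_dim (l : KD4_label) : nat :=
  match l with
  | I0 | I1 | I2 | I3 | I4 => 2
  | J0 | J2 | J1 | J3 | J20 | J21 | J22 | J23 | J24 => 4
  | K2 | K3 | K4 => 8
  end.

Definition KD4_proj (R : realType) (gT : finGroupType) (a b : gT)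
    (l : KD4_label) : group_algebra R[i] gT :=
  let e1 := e1 R 4 a b in
  let e2 := e2 R 4 a b in
  let e3 := e3 R 4 a b in
  let e4 := e4 R 4 a b in
  let r11 := r11 R 4 a b in
  let r22 := r22 R 4 a b in
  let p1 := p1 R 4 a b in
  let p2 := p2 R 4 a b in
  let q1 := q1 R 4 a b in
  let q2 := q2 R 4 a b in
  match l with
  | I0 => e1 + e2 + e3 + e4 + q1 + q2
  | I1 => e1 + e4 + q1 + p2
  | I2 => e1 + e4 + q1 + p1
  | I3 => e1 + e2 + e3 + e4 + r22 1 + r11 3
  | I4 => e1 + e2 + e3 + e4 + r11 1 + r22 3
  | J0 => e1 + e4 + q1
  | J2 => e1 + e4 + q2
  | J1 => e1 + e3 + r11 2
  | J3 => e1 + e3 + r22 2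
  | J20 => e1 + e2 + e3 + e4
  | J21 => e1 + e2 + r11 1
  | J22 => e1 + e2 + r22 1
  | J23 => e1 + e2 + r22 3
  | J24 => e1 + e2 + r11 3
  | K2 => e1 + e2
  | K3 => e1 + e3
  | K4 => e1 + e4
  end.

(* Main.v *)
Require Import Defs.
From Stdlib Require Import ZArith.
From HB Require Import structures.
From mathcomp Require Import all_boot all_order all_fingroup all_algebra.
From mathcomp Require Import reals trigo complex.
From mathcomp Require Import ring ssrZ.

Set Implicit Arguments.
Unset Strict Implicit.
Unset Printing Implicit Defensive.

Import Order.TTheory GRing.Theory Num.Theory.
Local Open Scope ring_scope.

(** Everything is read in a basis of the dual algebra. Let [rho_j] be the
    two-dimensional representation [a |-> diag(eps^j, eps^-j)], [b |-> swap] of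
    the dihedral group of order 16, for [j = 1, 2, 3]. An element [x] of [K] has
    16 coordinates: its values under the four characters, and the coefficients
    [t, u, v, w] of [2 rho_j(x) = t + u X + v Y + w Z] on the Pauli matrices.
    In this basis, multiplication in [K] is multiplication of Pauli matrices,
    and the product that the twisted coproduct induces on the dual has structure
    constants 0, 1 and -1, listed in [fusion_table]. Thus each axiom of
    the Kac algebra becomes a finite computation with integers.

    Let [L_i x] be the slice of [Delta x] by the [i]-th coordinate on the left
    leg. A subspace is a left coideal when the [L_i] preserve it. If [p] is the
    Jones projection of a coideal subalgebra [I] and [y] is in [I], then [L_i y]
    is in [I], so [L_i y * p = crd_i y *: p] for all [i] ([absorbs p y], which
    says [Delta(y)(1 (x) p) = y (x) p]). The converse comes from
      [\sum_i eta_i L_i (L_i y * p) = weight p *: y],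
    an identity that combines the antipode with the invariance of the Haar trace
    ([lslice_casimir]): if [p] absorbs [y], then [y] is a combination of the
    [L_i p]. So [I] is both the span of the [L_i p] and the set of all [y] that
    [p] absorbs, and conversely a projection [p] of counit 1 and nonzero weight
    that absorbs itself defines a coideal subalgebra ([coideal_of_coideal]).
    The same identity computes the dimension [16 / weight p], as the trace of
    the identity ([dim_coideal_of]), and multiplying by [p'] turns the inclusion
    of [I] in [I'] into [p p' = p'], the order of projections
    ([coideal_of_le], [cstar_le_proj]). Every coideal subalgebra has a Jones
    projection, as does every unital *-subalgebra of [K]
    ([jones_projection_exists]).

    It remains to find the idempotents [p] of counit 1 that absorb themselves.
    These are the solutions of a system of quadratic equations in 16 unknowns.
    The values of [p] under the characters are 0 or 1, and the characters of
    value 1 form a subgroup of the Klein four-group; such a nontrivial character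
    fixes [p], which kills or identifies most of the other coordinates, and in
    each of the five cases a few equations finish ([jones_listed]). The solutions are the
    coordinates of the 17 listed projections, of [1] (the scalars) and of [e1]
    (the whole algebra). *)

(** * Functionals on a group algebra *)

Section Functionals.
Variables (C : fieldType) (gT : finGroupType).
Local Notation A := (group_algebra C gT).
Implicit Types (x y : A) (f : gT -> C).

Definition ev f x : C := \sum_g f g * gcoef x g.

Lemma ev_linear f : linear (ev f : A -> C^o).
Proof.
move=> k x y; rewrite /ev scaler_sumr -big_split /=; apply: eq_bigr => g _.
by rewrite gcoefD gcoefZ mulrDr mulrCA.
Qed.

HB.instance Definition _ f :=
  GRing.isLinear.Build C A C^o _ (ev f) (ev_linear f).

Lemma evD f x y : ev f (x + y) = ev f x + ev f y.
Proof. exact: raddfD. Qed.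

Lemma evZ f k x : ev f (k *: x) = k * ev f x.
Proof. exact: linearZ. Qed.

Lemma ev_sum f (J : Type) (r : seq J) (P : pred J) (F : J -> A) :
  ev f (\sum_(j <- r | P j) F j) = \sum_(j <- r | P j) ev f (F j).
Proof. exact: raddf_sum. Qed.

Lemma eq_ev f f' x : f =1 f' -> ev f x = ev f' x.
Proof. by move=> eqf; apply: eq_bigr => g _; rewrite eqf. Qed.

Lemma ev_lambda f g : ev f (lambda C g) = f g.
Proof.
rewrite /ev (bigD1 g) //= gcoefE eqxx mulr1 big1 ?addr0 // => h /negbTE hg.
by rewrite gcoefE hg mulr0.
Qed.

Lemma gcoef_sum (J : Type) (r : seq J) (P : pred J) (F : J -> A) g :
  gcoef (\sum_(j <- r | P j) F j) g = \sum_(j <- r | P j) gcoef (F j) g.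
Proof.
exact: (big_morph (fun z : A => gcoef z g) (fun u v => gcoefD u v g)
  (gcoef0 C g)).
Qed.

Lemma lambda_sum x : x = \sum_g gcoef x g *: lambda C g.
Proof.
apply: gcoefP => h; rewrite gcoef_sum (bigD1 h) //= gcoefZ gcoefE eqxx mulr1.
rewrite big1 ?addr0 // => g hg.
by rewrite gcoefZ gcoefE eq_sym (negbTE hg) mulr0.
Qed.

Lemma gcoef_mul x y g :
  gcoef (x * y) g = \sum_h gcoef x h * gcoef y (h^-1 * g)%g.
Proof. exact: gcoefE. Qed.

Lemma lambdaM g h : lambda C g * lambda C h = @lambda C gT (g * h)%g.
Proof.
apply: gcoefP => k; rewrite gcoef_mul gcoefE (bigD1 g) //= !gcoefE eqxx mul1r.
rewrite big1 ?addr0; last by move=> j /negbTE jg; rewrite gcoefE jg mul0r.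
by rewrite -(inj_eq (mulgI g)) mulKVg.
Qed.

Lemma ev_lambdaM f g x : ev f (lambda C g * x) = ev (fun h => f (g * h)%g) x.
Proof.
rewrite {1}(lambda_sum x) mulr_sumr ev_sum; apply: eq_bigr => h _.
by rewrite -gscalerAr lambdaM evZ ev_lambda mulrC.
Qed.

Lemma ev_Mlambda f g x : ev f (x * lambda C g) = ev (fun h => f (h * g)%g) x.
Proof.
rewrite {1}(lambda_sum x) mulr_suml ev_sum; apply: eq_bigr => h _.
by rewrite -gscalerAl lambdaM evZ ev_lambda mulrC.
Qed.

Lemma gcoef_ev x g : gcoef x g = ev (fun h => (h == g)%:R) x.
Proof.
rewrite /ev (bigD1 g) //= eqxx mul1r big1 ?addr0 // => h /negbTE->.
by rewrite mul0r.
Qed.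

End Functionals.

(** * Tensors and their slices *)

Section Slices.
Variables (C : fieldType) (gT : finGroupType).
Local Notation A := (group_algebra C gT).
Local Notation AA := (group_algebra C (gT * gT)%type).
Implicit Types (x y : A) (X Y : AA) (f : gT -> C).

Definition ftensor (f f' : gT -> C) : gT * gT -> C := fun u => f u.1 * f' u.2.

Definition slice f X : A := gmk (fun h => \sum_g f g * gcoef X (g, h)).

Lemma ev_slice f (f' : gT -> C) X : ev f' (slice f X) = ev (ftensor f f') X.
Proof.
transitivity (\sum_g \sum_h ftensor f f' (g, h) * gcoef X (g, h)); last first.
  by rewrite pair_bigA; apply: eq_bigr => -[].
rewrite exchange_big /=; apply: eq_bigr => h _.
rewrite gcoefE mulr_sumr; apply: eq_bigr => g _.
by rewrite /ftensor /= mulrCA mulrA.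
Qed.

Lemma gcoef_gtensor x y u : gcoef (gtensor x y) u = gcoef x u.1 * gcoef y u.2.
Proof. exact: gcoefE. Qed.

Lemma slice_gtensor f x y : slice f (gtensor x y) = ev f x *: y.
Proof.
apply: gcoefP => h; rewrite gcoefZ gcoefE /ev mulr_suml.
by apply: eq_bigr => g _; rewrite gcoefE /= mulrA.
Qed.

Lemma gtensor_lambda g h :
  gtensor (lambda C g) (lambda C h) = @lambda C (gT * gT)%type (g, h).
Proof.
by apply: gcoefP => -[k l]; rewrite !gcoefE /= xpair_eqE -natrM mulnb.
Qed.

Lemma ev_group_coproduct (F : gT * gT -> C) x :
  ev F (group_coproduct x) = ev (fun g => F (g, g)) x.
Proof.
rewrite /group_coproduct ev_sum; apply: eq_bigr => g _.
by rewrite evZ gtensor_lambda ev_lambda mulrC.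
Qed.

Lemma slice_linear f : linear (slice f : AA -> A).
Proof.
move=> k X Y; apply: gcoefP => h; rewrite gcoefD gcoefZ !gcoefE mulr_sumr.
rewrite -big_split /=; apply: eq_bigr => g _.
by rewrite gcoefD gcoefZ mulrDr mulrCA.
Qed.

HB.instance Definition _ f :=
  GRing.isLinear.Build C AA A _ (slice f) (slice_linear f).

(** The coefficient of [X] on [lambda g] in the left leg. *)
Definition right_leg g X : A := slice (fun h => (h == g)%:R) X.

Lemma gcoef_right_leg g X h : gcoef (right_leg g X) h = gcoef X (g, h).
Proof.
rewrite gcoefE (bigD1 g) //= eqxx mul1r big1 ?addr0 // => k /negbTE->.
by rewrite mul0r.
Qed.

Lemma slice_right_leg f X : slice f X = \sum_g f g *: right_leg g X.
Proof.
apply: gcoefP => h; rewrite gcoef_sum gcoefE.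
by apply: eq_bigr => g _; rewrite gcoefZ gcoef_right_leg.
Qed.

Lemma sum_gtensor_right_leg X : X = \sum_g gtensor (lambda C g) (right_leg g X).
Proof.
apply: gcoefP => -[g h]; rewrite gcoef_sum (bigD1 g) //=.
rewrite gcoefE /= gcoefE eqxx mul1r gcoef_right_leg big1 ?addr0 // => k kg.
by rewrite !gcoefE /= eq_sym (negbTE kg) mul0r.
Qed.

Lemma gtensorZl k x y : gtensor (k *: x) y = k *: gtensor x y.
Proof. by apply: gcoefP => u; rewrite gcoefZ !gcoef_gtensor gcoefZ mulrA. Qed.

Lemma gtensorZr k x y : gtensor x (k *: y) = k *: gtensor x y.
Proof. by apply: gcoefP => u; rewrite gcoefZ !gcoef_gtensor gcoefZ mulrCA. Qed.

Lemma gtensor_suml (J : finType) (F : J -> A) y :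
  gtensor (\sum_j F j) y = \sum_j gtensor (F j) y.
Proof.
apply: gcoefP => u; rewrite gcoef_sum gcoef_gtensor gcoef_sum mulr_suml.
by apply: eq_bigr => j _; rewrite gcoef_gtensor.
Qed.

Lemma gtensor_sumr (J : finType) (F : J -> A) x :
  gtensor x (\sum_j F j) = \sum_j gtensor x (F j).
Proof.
apply: gcoefP => u; rewrite gcoef_sum gcoef_gtensor gcoef_sum mulr_sumr.
by apply: eq_bigr => j _; rewrite gcoef_gtensor.
Qed.

Lemma gtensor_tensorv (U V : {vspace A}) x y :
  x \in U -> y \in V -> gtensor x y \in tensorv U V.
Proof.
move=> /coord_vbasis -> /coord_vbasis ->.
rewrite gtensor_suml; apply: memv_suml => i _; rewrite gtensorZl memvZ //.
rewrite gtensor_sumr; apply: memv_suml => j _; rewrite gtensorZr memvZ //.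
apply: memv_span; apply/allpairsP; exists ((vbasis U)`_i, (vbasis V)`_j).
by split=> //; apply: mem_nth; rewrite size_tuple.
Qed.

(** The left legs being arbitrary, a tensor lies in [K (x) V] exactly when all
    its right legs lie in [V]. *)
Lemma tensorv_fullP (V : {vspace A}) X :
  reflect (forall g, right_leg g X \in V) (X \in tensorv fullv V).
Proof.
apply: (iffP idP) => [XV g | rV].
  have -> : right_leg g X = linfun (slice (fun h => (h == g)%:R)) X.
    by rewrite lfunE.
  move: XV => /(memv_img (linfun (slice (fun h => (h == g)%:R)))).
  rewrite /tensorv limg_span; apply: subvP; apply/span_subvP.
  move=> _ /mapP[_ /allpairsP[[x y] /= [_ yV ->]] ->].
  by rewrite lfunE /= slice_gtensor memvZ // vbasis_mem.
rewrite (sum_gtensor_right_leg X); apply: memv_suml => g _.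
by rewrite gtensor_tensorv ?memvf.
Qed.

End Slices.

(** * Jones projections and the order of projections *)

Section Star.
Variables (C : numClosedFieldType) (gT : finGroupType).
Local Notation A := (group_algebra C gT).
Implicit Types (x y z : A).

Lemma gcoef_star x g : gcoef (gstar x) g = (gcoef x g^-1%g)^*.
Proof. exact: gcoefE. Qed.

Lemma gstarD x y : gstar (x + y) = gstar x + gstar y.
Proof. by apply: gcoefP => g; rewrite gcoefD !gcoef_star gcoefD rmorphD. Qed.

Lemma gstarZ k x : gstar (k *: x) = k^* *: gstar x.
Proof. by apply: gcoefP => g; rewrite gcoefZ !gcoef_star gcoefZ rmorphM. Qed.

Lemma gstarN x : gstar (- x) = - gstar x.
Proof. by rewrite -!scaleN1r gstarZ rmorphN rmorph1. Qed.

Lemma gstarB x y : gstar (x - y) = gstar x - gstar y.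
Proof. by rewrite gstarD gstarN. Qed.

Lemma gstar_sum (J : Type) (r : seq J) (P : pred J) (F : J -> A) :
  gstar (\sum_(j <- r | P j) F j) = \sum_(j <- r | P j) gstar (F j).
Proof.
apply: (big_morph _ gstarD); apply: gcoefP => g.
by rewrite gcoef_star !gcoef0 rmorph0.
Qed.

Lemma gstarK : involutive (@gstar C gT).
Proof. by move=> x; apply: gcoefP => g; rewrite !gcoef_star invgK conjCK. Qed.

Lemma gstar_lambda g : gstar (lambda C g) = @lambda C gT g^-1%g.
Proof.
by apply: gcoefP => h; rewrite gcoef_star !gcoefE rmorph_nat -eq_invg_sym.
Qed.

Lemma gstarM x y : gstar (x * y) = gstar y * gstar x.
Proof.
rewrite (lambda_sum x) (lambda_sum y) mulr_suml !gstar_sum mulr_sumr.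
apply: eq_bigr => g _; rewrite mulr_sumr gstar_sum mulr_suml.
apply: eq_bigr => h _; rewrite -gscalerAl -gscalerAr !gstarZ.
rewrite -gscalerAl -gscalerAr lambdaM !gstar_lambda lambdaM invMg.
by rewrite scalerA mulrC -scalerA.
Qed.

Lemma gstar1 : gstar (1 : A) = 1.
Proof. by rewrite gstar_lambda invg1. Qed.

Lemma gcoef_star_mul x y :
  gcoef (gstar x * y) 1%g = \sum_g (gcoef x g)^* * gcoef y g.
Proof.
rewrite gcoef_mul (reindex_inj invg_inj) /=; apply: eq_bigr => g _.
by rewrite gcoef_star invgK mulg1.
Qed.

Lemma gcoef_star_mul_ge0 x : 0 <= gcoef (gstar x * x) 1%g.
Proof.
by rewrite gcoef_star_mul sumr_ge0 // => g _; rewrite mulrC mul_conjC_ge0.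
Qed.

(** Faithfulness of the canonical trace [x |-> gcoef x 1]; this plays the part of
    the C*-norm below. *)
Lemma gcoef_star_mul_eq0 x : gcoef (gstar x * x) 1%g = 0 -> x = 0.
Proof.
rewrite gcoef_star_mul => /eqP; rewrite psumr_eq0; last first.
  by move=> g _; rewrite mulrC mul_conjC_ge0.
move=> /allP x0; apply: gcoefP => g; rewrite gcoef0; apply/eqP.
by have := x0 g (mem_index_enum g); rewrite mulrC mul_conjC_eq0.
Qed.

Lemma counit_ev x : counit x = ev (fun=> 1) x.
Proof. by apply: eq_bigr => g _; rewrite mul1r. Qed.

Lemma counitD x y : counit (x + y) = counit x + counit y.
Proof. by rewrite !counit_ev evD. Qed.

Lemma counitZ k x : counit (k *: x) = k * counit x.
Proof. by rewrite !counit_ev evZ. Qed.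

Lemma counitM x y : counit (x * y) = counit x * counit y.
Proof.
rewrite (lambda_sum x) mulr_suml !counit_ev !ev_sum mulr_suml.
apply: eq_bigr => g _; rewrite -gscalerAl !evZ ev_lambda mulr1 ev_lambdaM.
by congr (_ * _); apply: eq_ev.
Qed.

Lemma counit1 : counit (1 : A) = 1.
Proof. by rewrite counit_ev ev_lambda. Qed.

Lemma counit_star x : counit (gstar x) = (counit x)^*.
Proof.
rewrite /counit rmorph_sum (reindex_inj invg_inj) /=; apply: eq_bigr => g _.
by rewrite gcoef_star invgK.
Qed.

(** ** Jones projections of *-subalgebras *)

Lemma projection_eps (I : {vspace A}) q :
  q \in I -> is_projection q -> q != 0 ->
  {in I, forall y, y * q = counit y *: q} -> counit q = 1.
Proof.
move=> qI [_ qq] q0 qE; have := qE q qI; rewrite qq => /eqP.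
rewrite -{1}[q]scale1r -subr_eq0 -scalerBl scaler_eq0 (negbTE q0) orbF subr_eq0.
by move=> /eqP.
Qed.

(** Any two such projections absorb each other on both sides. *)
Lemma jones_projectionI (I : {vspace A}) p :
  p \in I -> is_projection p -> p != 0 ->
  {in I, forall y, y * p = counit y *: p} -> jones_projection I p.
Proof.
move=> pI pp p0 pE; split; first by split.
move=> q [qI qq q0 qE].
have pq : p * q = q by rewrite qE // (projection_eps pI pp p0 pE) scale1r.
have qp : q * p = p by rewrite pE // (projection_eps qI qq q0 qE) scale1r.
by rewrite -pp.1 -qp gstarM pp.1 qq.1.
Qed.

(** The vector of [I] orthogonal to the ideal [ker counit] of [I] is killed by
    that ideal from the left, so up to a scalar it is the projection. *)
Lemma jones_projection_exists (I : {vspace A}) :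
  1 \in I -> {in I &, forall x y, x * y \in I} ->
  {in I, forall x, gstar x \in I} -> exists p, jones_projection I p.
Proof.
move=> I1 IM Istar.
pose eps := linfun (ev (fun=> 1) : A -> C^o).
have epsE x : eps x = counit x by rewrite lfunE counit_ev.
pose N := (I :&: lker eps)%VS.
have NP x : reflect (x \in I /\ counit x = 0) (x \in N).
  rewrite memv_cap memv_ker epsE.
  by apply: (iffP andP) => -[xI /eqP].
pose ip x y : C := gcoef (gstar x * y) 1%g.
have ip_lin x : linear (ip x : A -> C^o).
  by move=> k y z; rewrite /ip mulrDr -gscalerAr gcoefD gcoefZ.
pose phi (y : A) : {ffun 'I_(\dim N) -> C^o} :=
  [ffun j : 'I_(\dim N) => ip (vbasis N)`_j y].
have phi_lin : linear phi.
  by move=> k y z; apply/ffunP => j; rewrite !ffunE; apply: ip_lin.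
pose phiL : {linear A -> {ffun 'I_(\dim N) -> C^o}} :=
  HB.pack phi (GRing.isLinear.Build C A {ffun 'I_(\dim N) -> C^o} _ _ phi_lin).
have N_dim : (\dim N < \dim I)%N.
  rewrite ltn_neqAle dimvS ?capvSl // andbT.
  apply/negP => /eqP dNI; have /eqP NI : N == I by rewrite eqEdim capvSl dNI leqnn.
  by have := I1; rewrite -NI => /NP[_ /eqP]; rewrite counit1 oner_eq0.
have [q [qI q0 qN]] : exists q, [/\ q \in I, q != 0 & {in N, forall n, ip n q = 0}].
  have : (I :&: lker (linfun phiL))%VS != 0%VS.
    rewrite -dimv_eq0 -lt0n.
    have := limg_ker_dim (linfun phiL) I => /eqP; rewrite eq_sym => /eqP dI.
    rewrite -(ltn_add2r (\dim (linfun phiL @: I))) add0n -dI.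
    apply: leq_ltn_trans N_dim; apply: leq_trans (dimvS (subvf _)) _.
    by rewrite dimvf /dim /= card_ord muln1.
  rewrite -vpick0 => nz; have := memv_pick (I :&: lker (linfun phiL)).
  set q := vpick _ in nz *.
  rewrite memv_cap memv_ker lfunE => /andP[qI /eqP/ffunP q0].
  exists q; split=> // n /coord_vbasis ->.
  rewrite /ip gstar_sum mulr_suml gcoef_sum big1 // => j _.
  rewrite gstarZ -gscalerAl gcoefZ; have := q0 j; rewrite !ffunE /ip => ->.
  by rewrite mulr0.
have kill : {in N, forall n, n * q = 0}.
  move=> n /[dup] nN /NP[nI n0]; apply: gcoef_star_mul_eq0.
  have : n * q \in N by apply/NP; split; [exact: IM | rewrite counitM n0 mul0r].
  move=> nqN; have : gstar n * (n * q) \in N.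
    apply/NP; split; first by rewrite IM ?Istar // IM.
    by rewrite !counitM n0 mul0r mulr0.
  by move=> /qN; rewrite /ip gstarM gstarK -mulrA.
have qE : {in I, forall y, y * q = counit y *: q}.
  move=> y yI; apply/eqP; rewrite -subr_eq0 -[_ *: q]mul1r -gscalerAr gscalerAl.
  rewrite -mulrBl kill //; apply/NP; split; first by rewrite memvB ?memvZ.
  by rewrite counitD -scaleN1r !counitZ counit1 mulr1 mulN1r subrr.
have qqE : gstar q * q = (counit q)^* *: q by rewrite qE ?Istar // counit_star.
have eq0 : counit q != 0.
  apply/eqP => e0; case/negP: q0; apply/eqP/gcoef_star_mul_eq0.
  by rewrite qqE e0 rmorph0 scale0r gcoef0.
have starq : (counit q)^* *: q = counit q *: gstar q.
  by have := congr1 (@gstar C gT) qqE; rewrite gstarM gstarK gstarZ conjCK qqE.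
exists ((counit q)^-1 *: q); apply: jones_projectionI.
- exact: memvZ.
- split; last by rewrite -gscalerAl -gscalerAr qE // !scalerA divfK.
  rewrite gstarZ fmorphV; apply: (scalerI eq0).
  rewrite scalerA mulrC -scalerA -starq !scalerA mulVf ?conjC_eq0 //.
  by rewrite divff.
- by rewrite scaler_eq0 invr_eq0 negb_or eq0.
- by move=> y yI; rewrite -gscalerAr qE // !scalerA mulrC.
Qed.

(** ** The order of projections *)

Lemma gstar_mul_sum_eq0 x y : gstar x * x + gstar y * y = 0 -> x = 0.
Proof.
move=> e; apply: gcoef_star_mul_eq0; have := congr1 (fun z : A => gcoef z 1%g) e.
rewrite gcoefD gcoef0 => /eqP; rewrite paddr_eq0 ?gcoef_star_mul_ge0 //.
by case/andP => /eqP.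
Qed.

(** If [p - q = z^* z] then [(1 - p) (p - q) (1 - p)] and [(1 - p) q (1 - p)] are
    of the form [x^* x] and have sum 0, so [q (1 - p) = 0]. Conversely [p - q] is
    then a projection. *)
Lemma cstar_le_proj (p q : A) :
  is_projection p -> is_projection q -> (cstar_le q p <-> p * q = q).
Proof.
move=> [ps pp] [qs qq]; split=> [[z zE] | pq].
  have q1p : q * (1 - p) = 0.
    apply: (@gstar_mul_sum_eq0 _ (z * (1 - p))).
    rewrite !gstarM gstarB gstar1 ps qs.
    have -> : (1 - p) * gstar z * (z * (1 - p)) = (1 - p) * (p - q) * (1 - p).
      by rewrite zE !mulrA.
    have -> : (1 - p) * q * (q * (1 - p)) = (1 - p) * q * (1 - p).
      by rewrite !mulrA -(mulrA _ q q) qq.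
    rewrite -mulrDl -mulrDr addrCA subrr addr0 mulrBl mul1r pp subrr mul0r //.
  move: q1p; rewrite mulrBr mulr1 => /eqP; rewrite subr_eq0 => /eqP qp.
  by rewrite -[in LHS]qs -{1}ps -gstarM -qp.
have qp : q * p = q by rewrite -[in LHS]qs -{1}ps -gstarM pq.
exists (p - q); rewrite gstarB ps qs mulrBl !mulrBr pp pq qp qq subrr subr0 //.
Qed.
End Star.

(** * Formal combinations with Gaussian integer coefficients *)

(** The pair [(m, n)] stands for [m + n 'i]. Formal combinations over these
    coefficients are what the kernel computes with; [ceval] maps them to [C]. *)
Definition gint : Type := (Z * Z)%type.
Definition gz (z : Z) : gint := (z, Z0).
Definition gadd (z t : gint) : gint := (Z.add z.1 t.1, Z.add z.2 t.2).
Definition gmult (z t : gint) : gint :=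
  (Z.sub (Z.mul z.1 t.1) (Z.mul z.2 t.2), Z.add (Z.mul z.1 t.2) (Z.mul z.2 t.1)).
Definition gconj (z : gint) : gint := (z.1, Z.opp z.2).
Definition gzero (z : gint) : bool := Z.eqb z.1 0 && Z.eqb z.2 0.

Definition comb (M : Type) : Type := seq (gint * M).

Definition cscale M (k : gint) (c : comb M) : comb M :=
  [seq (gmult k t.1, t.2) | t <- c].

Definition csubst M N (f : M -> comb N) (c : comb M) : comb N :=
  flatten [seq cscale t.1 (f t.2) | t <- c].

Definition cprod M N (c : comb M) (d : comb N) : comb (M * N) :=
  csubst (fun m => [seq (t.1, (m, t.2)) | t <- d]) c.

Fixpoint cinsert (M : eqType) (k : gint) (m : M) (c : comb M) : comb M :=
  if c is t :: c' then
    if t.2 == m then (gadd k t.1, m) :: c' else t :: cinsert k m c'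
  else [:: (k, m)].

Definition cnorm (M : eqType) (c : comb M) : comb M :=
  foldr (fun t => cinsert t.1 t.2) [::] c.

(** Equality of formal combinations, decided by collecting the coefficients of
    [c - d]. *)
Definition ceq (M : eqType) (c d : comb M) : bool :=
  all (fun t => gzero t.1) (cnorm (c ++ cscale (Zneg 1, Z0) d)).

Lemma two_neq0 (F : numDomainType) : (2 : F) != 0.
Proof. by rewrite (pnatr_eq0 F 2). Qed.

Section Evaluation.
Variable C : numClosedFieldType.

Definition zeval (z : Z) : C := (int_of_Z z)%:~R.
Definition geval (z : gint) : C := zeval z.1 + 'i * zeval z.2.
Definition ceval M (v : M -> C) (c : comb M) : C :=
  \sum_(t <- c) geval t.1 * v t.2.

Lemma zevalD : {morph zeval : x y / Z.add x y >-> x + y}.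
Proof. by move=> x y; rewrite /zeval -intrD -(raddfD int_of_Z). Qed.

Lemma zevalN : {morph zeval : x / Z.opp x >-> - x}.
Proof. by move=> x; rewrite /zeval -mulrNz -(raddfN int_of_Z). Qed.

Lemma zevalB : {morph zeval : x y / Z.sub x y >-> x - y}.
Proof. by move=> x y; rewrite -zevalN -zevalD. Qed.

Lemma zevalM : {morph zeval : x y / Z.mul x y >-> x * y}.
Proof. by move=> x y; rewrite /zeval -intrM -(rmorphM int_of_Z). Qed.

Lemma gevalD : {morph geval : x y / gadd x y >-> x + y}.
Proof. by move=> x y; rewrite /geval /= !zevalD mulrDr addrACA. Qed.

Lemma gevalM : {morph geval : x y / gmult x y >-> x * y}.
Proof.
move=> x y; rewrite /geval /= zevalB zevalD !zevalM.
rewrite -[in LHS]mulN1r -(sqrCi C); ring.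
Qed.

Lemma geval_conj z : geval (gconj z) = (geval z)^*.
Proof.
rewrite /geval rmorphD rmorphM /= conjCi /zeval !rmorph_int -/(zeval _).
by rewrite -/(zeval _) zevalN mulrN mulNr.
Qed.

Lemma geval0 z : gzero z -> geval z = 0.
Proof.
case: z => x y /andP[/Z.eqb_eq /= -> /Z.eqb_eq /= ->].
by rewrite /geval /zeval mulr0 addr0.
Qed.

Lemma ceval_cat M (v : M -> C) c d : ceval v (c ++ d) = ceval v c + ceval v d.
Proof. exact: big_cat. Qed.

Lemma ceval_scale M (v : M -> C) k c : ceval v (cscale k c) = geval k * ceval v c.
Proof.
rewrite /ceval big_map mulr_sumr; apply: eq_bigr => t _.
by rewrite gevalM mulrA.
Qed.

Lemma ceval_cons M (v : M -> C) t c :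
  ceval v (t :: c) = geval t.1 * v t.2 + ceval v c.
Proof. exact: big_cons. Qed.

Lemma ceval_nil M (v : M -> C) : ceval v [::] = 0.
Proof. exact: big_nil. Qed.

(** Substitution is composition of linear maps: this is how an identity between
    structure maps is reduced to a check by [ceq]. *)
Lemma ceval_subst M N (v : N -> C) (f : M -> comb N) c :
  ceval v (csubst f c) = ceval (fun m => ceval v (f m)) c.
Proof.
elim: c => [|t c IH]; first by rewrite !ceval_nil.
by rewrite /csubst /= ceval_cat ceval_scale IH ceval_cons.
Qed.

Lemma eq_ceval M (v w : M -> C) c : v =1 w -> ceval v c = ceval w c.
Proof. by move=> vw; apply: eq_bigr => t _; rewrite vw. Qed.

Lemma ceval_prod M N (v : M * N -> C) c d :
  ceval v (cprod c d) = ceval (fun m => ceval (fun n => v (m, n)) d) c.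
Proof.
by rewrite ceval_subst; apply: eq_ceval => m; rewrite /ceval big_map.
Qed.

Lemma ceval_norm (M : eqType) (v : M -> C) c : ceval v (cnorm c) = ceval v c.
Proof.
have ins k m d : ceval v (cinsert k m d) = geval k * v m + ceval v d.
  elim: d => [|t d IH] /=; first by rewrite ceval_cons.
  case: eqP => [<-|_]; rewrite !ceval_cons.
    by rewrite gevalD mulrDl addrA.
  by rewrite IH addrCA.
by elim: c => //= t c IH; rewrite ins IH ceval_cons.
Qed.

Lemma ceqP (M : eqType) (v : M -> C) c d : ceq c d -> ceval v c = ceval v d.
Proof.
move=> /allP z; apply/eqP; rewrite -subr_eq0; apply/eqP.
transitivity (ceval v (cnorm (c ++ cscale (Zneg 1, Z0) d))).
  rewrite ceval_norm ceval_cat ceval_scale.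
  rewrite [geval (_, _)](_ : _ = -1) ?mulN1r //.
  by rewrite /geval /= (zevalN 1) /zeval mulr0 addr0.
by rewrite /ceval big_seq big1 // => t /z /geval0->; rewrite mul0r.
Qed.

End Evaluation.

(** * The dual algebra *)

(** [(m, l)] stands for the function on the dihedral group that takes
    [b^l a^k] to [eps^(m k)] and vanishes on the other coset of [<a>]. The exponent
    [m] counts modulo 8, and [7 * m %% 8] is its opposite. *)
Definition mono : eqType := (nat * bool)%type.

Definition gi : gint := (Z0, Zpos 1).
Definition gsign (b : bool) : gint := gz (if b then Zneg 1 else Zpos 1).

(** The coordinate functions, first the four characters, in the order of the
    idempotents [e1, e2, e3, e4], then [t, u, v, w] for [j = 1, 2, 3]. Here
    [rho_j] takes [b^l a^k] to [diag(eps^(j k), eps^(-j k))], with exchanged rows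
    when [l] is 1, and, for instance, [v = 'i M_12 - 'i M_21] on a matrix [M]. *)
Definition pauli (i : nat) : comb mono :=
  let one := gz 1 in let mone := gz (-1) in
  match i with
  | 0 => [:: (one, (0, false)); (one, (0, true))]
  | 1 => [:: (one, (0, false)); (mone, (0, true))]
  | 2 => [:: (one, (4, false)); (mone, (4, true))]
  | 3 => [:: (one, (4, false)); (one, (4, true))]
  | _ =>
    let j := (i %/ 4)%N in let k := (8 - j)%N in
    match (i %% 4)%N with
    | 0 => [:: (one, (j, false)); (one, (k, false))]
    | 1 => [:: (one, (j, true)); (one, (k, true))]
    | 2 => [:: (gi, (k, true)); (gconj gi, (j, true))]
    | _ => [:: (one, (j, false)); (mone, (k, false))]
    end
  end%N.

Local Open Scope Z_scope.

(** The product of the dual algebra: the entry in row [i] and column [j] lists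
    the terms of the product of [pauli i] and [pauli j], [k + 1] standing for
    [pauli k] and [- (k + 1)] for its opposite. *)
Definition fusion_table : seq (seq (seq Z)) :=
 [:: [:: [:: 1]; [:: 2]; [:: 3]; [:: 4]; [:: 5]; [:: 6]; [:: 7]; [:: 8];
        [:: 9]; [:: 10]; [:: 11]; [:: 12]; [:: 13]; [:: 14]; [:: 15]; [:: 16]];
     [:: [:: 2]; [:: 1]; [:: 4]; [:: 3]; [:: 5]; [:: -6]; [:: 7]; [:: -8];
        [:: 9]; [:: -10]; [:: -11]; [:: 12]; [:: 13]; [:: -14]; [:: 15];
        [:: -16]];
     [:: [:: 3]; [:: 4]; [:: 1]; [:: 2]; [:: 13]; [:: -14]; [:: -15]; [:: 16];
        [:: 9]; [:: -10]; [:: 11]; [:: -12]; [:: 5]; [:: -6]; [:: -7]; [:: 8]];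
     [:: [:: 4]; [:: 3]; [:: 2]; [:: 1]; [:: 13]; [:: 14]; [:: -15]; [:: -16];
        [:: 9]; [:: 10]; [:: -11]; [:: -12]; [:: 5]; [:: 6]; [:: -7]; [:: -8]];
     [:: [:: 5]; [:: 5]; [:: 13]; [:: 13]; [:: 1; 2; 9]; [::]; [:: 12]; [::];
        [:: 5; 13]; [::]; [::]; [:: 7; 15]; [:: 3; 4; 9]; [::]; [:: 12]; [::]];
     [:: [:: 6]; [:: -6]; [:: -14]; [:: 14]; [::]; [:: 1; -2; 10]; [::];
        [:: -11]; [::]; [:: 6; 14]; [:: -8; -16]; [::]; [::]; [:: -3; 4; 10];
        [::]; [:: -11]];
     [:: [:: 7]; [:: 7]; [:: -15]; [:: -15]; [:: -12]; [::]; [:: 1; 2; -9];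
        [::]; [:: -7; 15]; [::]; [::]; [:: -5; 13]; [:: 12]; [::];
        [:: -3; -4; 9]; [::]];
     [:: [:: 8]; [:: -8]; [:: 16]; [:: -16]; [::]; [:: 11]; [::];
        [:: -1; 2; 10]; [::]; [:: -8; 16]; [:: -6; 14]; [::]; [::]; [:: -11];
        [::]; [:: -3; 4; -10]];
     [:: [:: 9]; [:: 9]; [:: 9]; [:: 9]; [:: 5; 13]; [::]; [:: -7; 15]; [::];
        [:: 1; 2; 3; 4]; [::]; [::]; [::]; [:: 5; 13]; [::]; [:: 7; -15]; [::]];
     [:: [:: 10]; [:: -10]; [:: -10]; [:: 10]; [::]; [:: 6; 14]; [::];
        [:: -8; 16]; [::]; [:: 1; -2; -3; 4]; [::]; [::]; [::]; [:: 6; 14];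
        [::]; [:: 8; -16]];
     [:: [:: 11]; [:: -11]; [:: 11]; [:: -11]; [::]; [:: 8; 16]; [::];
        [:: 6; -14]; [::]; [::]; [:: 1; -2; 3; -4]; [::]; [::]; [:: -8; -16];
        [::]; [:: 6; -14]];
     [:: [:: 12]; [:: 12]; [:: -12]; [:: -12]; [:: -7; -15]; [::];
        [:: 5; -13]; [::]; [::]; [::]; [::]; [:: -1; -2; 3; 4]; [:: 7; 15];
        [::]; [:: 5; -13]; [::]];
     [:: [:: 13]; [:: 13]; [:: 5]; [:: 5]; [:: 3; 4; 9]; [::]; [:: -12]; [::];
        [:: 5; 13]; [::]; [::]; [:: -7; -15]; [:: 1; 2; 9]; [::]; [:: -12];
        [::]];
     [:: [:: 14]; [:: -14]; [:: -6]; [:: 6]; [::]; [:: -3; 4; 10]; [::];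
        [:: 11]; [::]; [:: 6; 14]; [:: 8; 16]; [::]; [::]; [:: 1; -2; 10];
        [::]; [:: 11]];
     [:: [:: 15]; [:: 15]; [:: -7]; [:: -7]; [:: -12]; [::]; [:: -3; -4; 9];
        [::]; [:: 7; -15]; [::]; [::]; [:: -5; 13]; [:: 12]; [::];
        [:: 1; 2; -9]; [::]];
     [:: [:: 16]; [:: -16]; [:: 8]; [:: -8]; [::]; [:: 11]; [::];
        [:: -3; 4; -10]; [::]; [:: 8; -16]; [:: -6; 14]; [::]; [::];
        [:: -11]; [::]; [:: -1; 2; 10]]].

Local Close Scope Z_scope.

Definition dmul (i j : nat) : comb nat :=
  [seq (gz (Z.sgn z), (Z.to_nat (Z.abs z)).-1)
     | z <- nth [::] (nth [::] fusion_table i) j].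

(** The function [g |-> m (h_r g)], where [h_0, h_1, h_2, h_3] are
    [1, a^4, b, b a^4]. The central element [a^4] acts by the sign [eps^(4 m)]. *)
Definition klein_lact (r : nat) (m : mono) : comb mono :=
  [:: (gsign (odd m.1 && odd r), (m.1, (1 < r)%N (+) m.2))].

(** The function [g |-> m (g h_r)]; moving [b] to the left of [a^k] inverts
    [a^k]. *)
Definition klein_ract (r : nat) (m : mono) : comb mono :=
  [:: (gsign (odd m.1 && odd r),
       ((if (1 < r)%N then (7 * m.1) %% 8 else m.1)%N, (1 < r)%N (+) m.2))].

(** The coefficients of [8 Omega]. *)
Definition omega_table : seq (seq gint) :=
  let nu := (Zneg 1, Zpos 2) in let one := gz 1 in
  [:: [:: gz 5; one;      one;      one     ];
      [:: one;  one;      gconj nu; nu      ];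
      [:: one;  nu;       one;      gconj nu];
      [:: one;  gconj nu; nu;       one     ]].

Definition omega_sum M (f : gint -> nat -> nat -> comb M) : comb M :=
  flatten [seq flatten [seq f (nth (gz 0) (nth [::] omega_table i) j) i j
                          | j <- iota 0 4] | i <- iota 0 4].

Definition omega_lact (u : mono * mono) : comb (mono * mono) :=
  omega_sum (fun c i j =>
    cscale c (cprod (klein_lact i u.1) (klein_lact j u.2))).

Definition omega_ract (u : mono * mono) : comb (mono * mono) :=
  omega_sum (fun c i j =>
    cscale (gconj c) (cprod (klein_ract i u.1) (klein_ract j u.2))).

(** The product dual to the untwisted coproduct. *)
Definition pointwise (u : mono * mono) : comb mono :=
  if u.1.2 == u.2.2 then [:: (gz 1, ((u.1.1 + u.2.1) %% 8, u.1.2))]%N else [::].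

(** [64] times the functional [x |-> c (Omega Delta_s(x) Omega^* )], a factor [8]
    coming from each side. The sides are normalized one after the other to keep
    the number of terms small. *)
Definition twisted (c : comb (mono * mono)) : comb mono :=
  csubst pointwise (cnorm (csubst omega_ract (cnorm (csubst omega_lact c)))).

Lemma fusion_table_twisted :
  all (fun i => all (fun j =>
    ceq (twisted (cprod (pauli i) (pauli j)))
        (cscale (gz 64) (csubst pauli (dmul i j)))) (iota 0 16)) (iota 0 16).
Proof. by vm_compute. Qed.

(** The expansion of [(g, h) |-> m (g h)]. *)
Definition mono_cop (m : mono) : comb (mono * mono) :=
  [:: (gz 1, (m, (m.1, false)));
      (gz 1, (((7 * m.1) %% 8, ~~ m.2), (m.1, true)))]%N.

(** Twice the expansion of [(x, y) |-> crd_i (x y)]: the factor 2 clears the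
    denominators of [rho_j(x) = (t + u X + v Y + w Z) / 2], and a block is then
    the multiplication table of the Pauli matrices. *)
Definition cop (i : nat) : comb (nat * nat) :=
  if (i < 4)%N then [:: (gz 2, (i, i))] else
  let t := (4 * (i %/ 4))%N in let u := t.+1 in let v := t.+2 in
  let w := t.+3 in let one := gz 1 in let mi := gconj gi in
  match (i %% 4)%N with
  | 0 => [:: (one, (t, t)); (one, (u, u)); (one, (v, v)); (one, (w, w))]
  | 1 => [:: (one, (t, u)); (one, (u, t)); (gi, (v, w)); (mi, (w, v))]
  | 2 => [:: (one, (t, v)); (one, (v, t)); (gi, (w, u)); (mi, (u, w))]
  | _ => [:: (one, (t, w)); (one, (w, t)); (gi, (u, v)); (mi, (v, u))]
  end%N.

Lemma cop_pauli :
  all (fun i =>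
    ceq (cscale (gz 2) (csubst mono_cop (pauli i)))
        (csubst (fun ab => cprod (pauli ab.1) (pauli ab.2)) (cop i)))
    (iota 0 16).
Proof. by vm_compute. Qed.

(** The next four tables are the axioms of a bialgebra, read in the dual:
    coassociativity, counit, multiplicativity of the coproduct, and
    [Delta(1) = 1 (x) 1]. *)
Lemma dmul_assoc :
  all (fun i => all (fun j => all (fun k =>
    ceq (csubst (dmul^~ k) (dmul i j)) (csubst (dmul i) (dmul j k)))
    (iota 0 16)) (iota 0 16)) (iota 0 16).
Proof. by vm_compute. Qed.

Lemma dmul_unit :
  all (fun i => ceq (dmul 0 i) [:: (gz 1, i)] && ceq (dmul i 0) [:: (gz 1, i)])
    (iota 0 16).
Proof. by vm_compute. Qed.

Lemma dmul_mult :
  all (fun i => all (fun j =>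
    ceq (cscale (gz 2) (csubst cop (dmul i j)))
        (csubst (fun u => cprod (dmul u.1.1 u.2.1) (dmul u.1.2 u.2.2))
           (cprod (cop i) (cop j))))
    (iota 0 16)) (iota 0 16).
Proof. by vm_compute. Qed.

Definition at_one (i : nat) : gint :=
  gz (if (i < 4)%N then 1 else if (i %% 4 == 0)%N then 2 else 0).

Lemma dmul_one :
  all (fun i => all (fun j =>
    ceq [seq (gmult t.1 (at_one t.2), tt) | t <- dmul i j]
        [:: (gmult (at_one i) (at_one j), tt)])
    (iota 0 16)) (iota 0 16).
Proof. by vm_compute. Qed.

(** The sign of [\sum_g f(g)^2 = 16 eta] for [f := pauli i]: the values of the
    coordinates [w_j] are the imaginary numbers [2 'i sin(j k pi / 4)], those of the
    other coordinates are real. *)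
Definition eta (i : nat) : gint := gsign ((3 < i) && (i %% 4 == 3))%N.

(** The regular character, which is 16 times the Haar trace. *)
Definition mass : comb nat :=
  [:: (gz 1, 0); (gz 1, 1); (gz 1, 2); (gz 1, 3); (gz 2, 4); (gz 2, 8);
      (gz 2, 12)]%N.

Definition casimir : comb nat := [seq (eta i, i) | i <- iota 0 16].

(** The functional part of [lslice_casimir]. In Sweedler notation, with [h] the
    Haar trace, the casimir element is [(x, y) |-> 16 h(x S(y))], and
      [h(y_1 S(y_2 p_1)) y_3 p_2 = h(S(y_2) y_1 S(p_1)) y_3 p_2
                                  = y h(S(p_1)) p_2 = h(p) y]
    since [h] is an invariant trace and [S] is an involution. *)
Lemma casimir_reproducing :
  all (fun j =>
    ceq (csubst (fun i => csubst (fun k => csubst (fun ab =>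
           cprod (dmul i ab.1) [:: (gz 1, ab.2)]) (cop k)) (dmul i j)) casimir)
        (cscale (gz 2) (cprod [:: (gz 1, j)] mass)))
    (iota 0 16).
Proof. by vm_compute. Qed.

Lemma casimir_trace : ceq (csubst (fun i => dmul i i) casimir) [:: (gz 16, 0%N)].
Proof. by vm_compute. Qed.

Definition mono_casimir : comb (mono * mono) :=
  [seq (gz 2, ((m, l), ((7 * m) %% 8, l)))%N
     | m <- iota 0 8, l <- [:: false; true]].

Lemma casimir_mono :
  ceq (csubst (fun i => cprod (pauli i) (pauli i)) casimir) mono_casimir.
Proof. by vm_compute. Qed.

Definition mono_conj (m : mono) : mono :=
  ((if m.2 then (7 * m.1) %% 8 else m.1)%N, m.2).

(** The representations are unitary and the Pauli matrices Hermitian. *)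
Lemma pauli_conj :
  all (fun i => ceq [seq (gconj t.1, mono_conj t.2) | t <- pauli i] (pauli i))
    (iota 0 16).
Proof. by vm_compute. Qed.

Lemma pauli_one :
  all (fun i => ceq [seq (t.1, tt) | t <- pauli i & ~~ t.2.2]
                    [:: (at_one i, tt)]) (iota 0 16).
Proof. by vm_compute. Qed.

Lemma dmul_bound :
  all (fun i => all (fun j => all (fun t => (t.2 < 16)%N) (dmul i j))
    (iota 0 16)) (iota 0 16).
Proof. by vm_compute. Qed.

Lemma cop_bound :
  all (fun i => all (fun t => (t.2.1 < 16) && (t.2.2 < 16))%N (cop i)) (iota 0 16).
Proof. by vm_compute. Qed.

(** * Words and modes on the dihedral group of order 16 *)

Section Dihedral.
Variables (gT : finGroupType) (a b : gT).
Hypothesis hab : dihedral_generators 4 a b.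

Definition word (l : bool) (k : nat) : gT := (b ^+ l * a ^+ k)%g.

Lemma expa_mod k : (a ^+ (k %% 8) = a ^+ k)%g.
Proof. by case: hab => _ a8 _ _ _; apply: expg_mod. Qed.

Lemma word_mod l k : word l (k %% 8) = word l k.
Proof. by rewrite /word expa_mod. Qed.

Lemma expa_b k : (a ^+ k * b = b * a ^+ (7 * k))%g.
Proof.
case: hab => _ a8 b2 ba _.
have aV : (a^-1 = a ^+ 7)%g by apply/eqP; rewrite eq_invg_mul -expgS a8.
have a1 : (a * b = b * a ^+ 7)%g.
  have : (a ^+ 7 * b = b * a)%g by rewrite -aV ba.
  move=> h; apply: (mulgI (a ^+ 7)%g).
  by rewrite mulgA -expgSr a8 mul1g mulgA h -mulgA -expgS a8 mulg1.
elim: k => [|k IH]; first by rewrite mul1g mulg1.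
by rewrite expgS -mulgA IH mulgA a1 -mulgA -expgD mulnS.
Qed.

Lemma word_mulb l k : (word l k * b = word (~~ l) (7 * k))%g.
Proof.
case: hab => _ _ b2 _ _; rewrite /word -mulgA expa_b mulgA -expgSr.
by case: l => //=; rewrite b2.
Qed.

Lemma word_mula l k j : (word l k * a ^+ j = word l (k + j))%g.
Proof. by rewrite /word -mulgA -expgD. Qed.

Lemma wordM l k l' k' :
  (word l k * word l' k')%g = word (l (+) l') ((if l' then 7 * k else k) + k')%N.
Proof.
rewrite {2}/word mulgA; case: l' => /=; last by rewrite mulg1 word_mula addbF.
by rewrite expg1 word_mulb word_mula addbT.
Qed.

Lemma word_surj g : exists l, exists2 k, (k < 8)%N & g = word l k.
Proof.
case: hab => gen a8 b2 _ _.
pose S := [set word u.1 u.2 | u : bool * 'I_8].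
have SP h : reflect (exists l k, h = word l k) (h \in S).
  apply: (iffP imsetP) => [[[l k] _ ->]|[l [k ->]]]; first by exists l, k.
  by exists (l, Ordinal (ltn_pmod k (isT : 0 < 8)%N)); rewrite //= word_mod.
have S1 : group_set S.
  apply/group_setP; split.
    by apply/SP; exists false, 0%N; rewrite /word mul1g.
  move=> _ _ /SP[l [k ->]] /SP[l' [k' ->]]; apply/SP; rewrite wordM.
  by do 2!eexists.
have sub : [set a; b] \subset Group S1.
  apply/subsetP => h; rewrite !inE => /orP[]/eqP->; apply/SP.
    by exists false, 1%N; rewrite /word mul1g.
  by exists true, 0%N; rewrite /word mulg1.
have gsub : <<[set a; b]>>%g \subset Group S1 by rewrite gen_subG.
have : g \in S by apply: (subsetP gsub); rewrite gen inE.
by move=> /imsetP[[l k] _ ->]; exists l, k.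
Qed.

(** The [2 * 8] words exhaust a group of order 16, so they are distinct. *)
Lemma word_inj (u v : bool * 'I_8) : word u.1 u.2 = word v.1 v.2 -> u = v.
Proof.
case: hab => _ _ _ _ card_G.
pose f (w : bool * 'I_8) := word w.1 w.2; apply: (_ : injective f).
apply/injectiveP/card_uniqP; rewrite size_map -cardE card_prod card_bool card_ord.
rewrite -[RHS]card_G; apply: eq_card => g; rewrite inE.
have [l [k k8 ->]] := word_surj g; apply/mapP.
by exists (l, Ordinal k8); rewrite // mem_enum.
Qed.

Lemma word_eq l k l' k' : (k < 8)%N -> (k' < 8)%N ->
  (word l k == word l' k') = (l == l') && (k == k').
Proof.
move=> k8 k8'; apply/eqP/andP => [|[/eqP-> /eqP->] //].
by move=> /(@word_inj (l, Ordinal k8) (l', Ordinal k8')) [-> ->].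
Qed.

Lemma word_inv l k : ((word l k)^-1)%g = word l (if l then k else 7 * k)%N.
Proof.
case: hab => _ a8 _ _ _; apply/eqP; rewrite eq_invg_mul wordM addbb /word mul1g.
by case: l; rewrite /= -?mulSnr -?mulSn expgM a8 expg1n.
Qed.

End Dihedral.

Section EighthRoot.
Variables (C : numClosedFieldType) (eps : C).
Hypothesis eps4 : eps ^+ 4 = -1.

Lemma eighth_root8 : eps ^+ 8 = 1.
Proof. by rewrite (exprM _ 4 2) eps4 sqrrN expr1n. Qed.

Lemma eighth_root_mod k : eps ^+ (k %% 8) = eps ^+ k.
Proof. exact: expr_mod eighth_root8. Qed.

Lemma eighth_root_neq0 : eps != 0.
Proof.
apply/eqP => e0; have := eighth_root8; rewrite e0 expr0n => /eqP.
by rewrite eq_sym oner_eq0.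
Qed.

Lemma eighth_rootV k : eps ^- k = eps ^+ (7 * k).
Proof.
apply: (mulfI (expf_neq0 k eighth_root_neq0)).
rewrite divff ?expf_neq0 ?eighth_root_neq0 //.
by rewrite -exprD -mulSn exprM eighth_root8 expr1n.
Qed.

Lemma eighth_root_conj k : (eps ^+ k)^* = eps ^+ (7 * k).
Proof.
have norm1 : `|eps| = 1.
  apply/eqP; rewrite -(@pexpr_eq1 _ _ 8) // -normrX eighth_root8 normr1 eqxx //.
have ee : eps^* * eps = 1 by rewrite mulrC -normCK norm1 expr1n.
rewrite rmorphXn /= -eighth_rootV -exprVn; congr (_ ^+ _).
by apply: (mulIf eighth_root_neq0); rewrite ee mulVf ?eighth_root_neq0.
Qed.

Lemma eighth_root_prim : 8.-primitive_root eps.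
Proof.
have [m pr_m dv_m] := prim_order_exists (isT : 0 < 8)%N eighth_root8.
have : ~~ (m %| 4)%N.
  by rewrite (prim_order_dvd pr_m) eps4 -subr_eq0 -opprD oppr_eq0 (pnatr_eq0 _ 2).
move=> m4; suff m8 : m = 8%N by rewrite -m8.
have := dvdn_leq (isT : 0 < 8)%N dv_m.
by case: m pr_m dv_m m4 => [|[|[|[|[|[|[|[|[|m]]]]]]]]].
Qed.

Lemma eighth_root_sum m :
  \sum_(k < 8) eps ^+ (m * k) = if (m %% 8 == 0)%N then 8%:R else 0.
Proof.
have [m0|m0] := ifPn.
  rewrite (eq_bigr (fun=> 1)) ?sumr_const ?card_ord // => k _.
  by rewrite exprM -eighth_root_mod (eqP m0) expr1n.
have nz : eps ^+ m - 1 != 0.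
  by rewrite subr_eq0 -(prim_order_dvd eighth_root_prim) /dvdn.
apply: (mulfI nz); rewrite mulr0.
rewrite (eq_bigr (fun k : 'I_8 => (eps ^+ m) ^+ k)); last first.
  by move=> k _; rewrite exprM.
by rewrite -subrX1 -exprM mulnC exprM eighth_root8 expr1n subrr.
Qed.
End EighthRoot.

Section Epsilon.
Variables (R : realType).
Local Notation eps := (epsilon R 4).

Lemma epsilon4 : eps ^+ 4 = -1.
Proof.
have eps2 : eps ^+ 2 = (0 +i* 1)%C.
  have pi2 : (pi / 4%:R : R) + pi / 4%:R = pi / 2 by field.
  rewrite /epsilon expr2; apply/eqP; rewrite eq_complex /=.
  have := cosD (pi / 4%:R : R) (pi / 4%:R); rewrite pi2 cos_pihalf => <-.
  have := sinD (pi / 4%:R : R) (pi / 4%:R); rewrite pi2 sin_pihalf addrC => <-.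
  by rewrite !eqxx.
rewrite (exprM _ 2 2) eps2 expr2; apply/eqP; rewrite eq_complex /=.
by rewrite !mul0r !mulr0 mulr1 sub0r addr0 oppr0 !eqxx.
Qed.

End Epsilon.

Lemma ceval_flatten (C : numClosedFieldType) M (v : M -> C) (s : seq (comb M)) :
  ceval v (flatten s) = \sum_(c <- s) ceval v c.
Proof.
by elim: s => [|c s IH]; rewrite ?big_nil ?ceval_nil // big_cons ceval_cat IH.
Qed.

Lemma ceval_omega (C : numClosedFieldType) M (v : M -> C) f :
  ceval v (omega_sum f) =
  \sum_(i < 4) \sum_(j < 4)
    ceval v (f (nth (gz 0) (nth [::] omega_table i) j) i j).
Proof.
rewrite ceval_flatten big_map -[iota 0 4]/(index_iota 0 4) big_mkord.
by apply: eq_bigr => i _; rewrite ceval_flatten big_map big_mkord.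
Qed.

Lemma ceval1 (C : numClosedFieldType) M (v : M -> C) k m :
  ceval v [:: (k, m)] = geval C k * v m.
Proof. by rewrite ceval_cons ceval_nil addr0. Qed.

Lemma geval_sign (C : numClosedFieldType) (c : bool) :
  geval C (gsign c) = (-1) ^+ c.
Proof. by case: c; rewrite /geval /= ?(zevalN _ 1) /zeval mulr0 addr0. Qed.

Lemma geval1 (C : numClosedFieldType) : geval C (gz 1) = 1.
Proof. exact: geval_sign false. Qed.

Lemma gevalN1 (C : numClosedFieldType) : geval C (gz (-1)) = -1.
Proof. exact: geval_sign true. Qed.

Lemma geval_gi (C : numClosedFieldType) : geval C gi = 'i.
Proof. by rewrite /geval /zeval mulr1 add0r. Qed.

Lemma geval_giN (C : numClosedFieldType) : geval C (gconj gi) = - 'i.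
Proof. by rewrite geval_conj geval_gi conjCi. Qed.

Lemma ev_ceval (C : numClosedFieldType) (gT : finGroupType) M
    (v : M -> gT -> C) c (x : group_algebra C gT) :
  ev (fun g => ceval (v^~ g) c) x = ceval (fun m => ev (v m) x) c.
Proof.
rewrite /ceval /ev; under eq_bigr do rewrite mulr_suml.
rewrite exchange_big /=; apply: eq_bigr => t _; rewrite mulr_sumr.
by apply: eq_bigr => g _; rewrite mulrA.
Qed.

Lemma ceval_mulr (C : numClosedFieldType) M (v : M -> C) c k :
  ceval v c * k = ceval (fun m => v m * k) c.
Proof. by rewrite /ceval mulr_suml; apply: eq_bigr => t _; rewrite mulrA. Qed.

Lemma ceval_mull (C : numClosedFieldType) M (v : M -> C) c k :
  k * ceval v c = ceval (fun m => k * v m) c.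
Proof. by rewrite /ceval mulr_sumr; apply: eq_bigr => t _; rewrite mulrCA. Qed.

Lemma ceval_sum (C : numClosedFieldType) M (J : finType) (F : J -> M -> C) c :
  ceval (fun m => \sum_j F j m) c = \sum_j ceval (F j) c.
Proof.
rewrite /ceval exchange_big /=; apply: eq_bigr => t _; exact: mulr_sumr.
Qed.

Lemma ev_fsum (C : fieldType) (gT : finGroupType) (J : finType)
    (F : J -> gT -> C) (x : group_algebra C gT) :
  ev (fun g => \sum_j F j g) x = \sum_j ev (F j) x.
Proof.
rewrite /ev exchange_big /=; apply: eq_bigr => g _; exact: mulr_suml.
Qed.

Lemma ev_fscale (C : fieldType) (gT : finGroupType) k (F : gT -> C)
    (x : group_algebra C gT) :
  ev (fun g => k * F g) x = k * ev F x.
Proof. by rewrite /ev mulr_sumr; apply: eq_bigr => g _; rewrite mulrA. Qed.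

(** * The coproduct of [KD(4)] in the Pauli coordinates *)

Section DualBasis.
Variables (C : numClosedFieldType) (eps : C) (gT : finGroupType) (a b : gT).
Hypothesis eps4 : eps ^+ 4 = -1.
Hypothesis hab : dihedral_generators 4 a b.
Local Notation K := (group_algebra C gT).
Local Notation KK := (group_algebra C (gT * gT)%type).
Local Notation word := (word a b).

Definition mode (u : mono) (g : gT) : C :=
  \sum_(k < 8) (g == word u.2 k)%:R * eps ^+ (u.1 * k).

Lemma mode_word u l k : mode u (word l k) = (l == u.2)%:R * eps ^+ (u.1 * k).
Proof.
rewrite -(word_mod hab) /mode (bigD1 (Ordinal (ltn_pmod k (isT : 0 < 8)%N))) //=.
rewrite (word_eq hab) ?ltn_pmod // eqxx andbT big1 ?addr0.
  by rewrite -(eighth_root_mod eps4) modnMmr (eighth_root_mod eps4).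
move=> j /eqP nj; rewrite (word_eq hab) ?ltn_pmod //.
case: (_ %% 8 =P _)%N => [ej|_]; last by rewrite andbF mul0r.
by case: nj; apply: val_inj.
Qed.

Local Notation klein i := (nth 1%g (Omega_group 4 a b) i).

Lemma klein_word i : (i < 4)%N -> klein i = word (1 < i)%N (4 * odd i).
Proof.
by case: i => [|[|[|[|]]]] //= _; rewrite /word ?mul1g ?mulg1 ?expg1.
Qed.

Lemma klein_inv i : (i < 4)%N -> ((klein i)^-1 = klein i)%g.
Proof.
move=> i4; rewrite !klein_word // (word_inv hab).
by case: i i4 => [|[|[|[|]]]] //= _; rewrite -(word_mod hab).
Qed.

Lemma epsilon_4M m (c : bool) : eps ^+ (m * (4 * c)) = (-1) ^+ (odd m && c).
Proof.
case: c; rewrite ?andbF ?andbT ?muln0 ?expr0 // muln1 mulnC exprM eps4.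
by rewrite signr_odd.
Qed.

Lemma klein_lactE i u g : (i < 4)%N ->
  mode u (klein i * g)%g = ceval (mode^~ g) (klein_lact i u).
Proof.
move=> i4; have [l [k _ ->]] := word_surj hab g.
rewrite klein_word // (wordM hab) ceval1 geval_sign !mode_word /=.
rewrite mulrCA; congr (_ * _); first by case: l (1 < i)%N u.2 => [] [] [].
rewrite mulnDr exprD; congr (_ * _); rewrite -epsilon_4M.
case: l => //; rewrite -(eighth_root_mod eps4) -modnMmr.
rewrite -[in RHS](eighth_root_mod eps4) -[in RHS]modnMmr.
by case: (odd i).
Qed.

Lemma klein_ractE i u g : (i < 4)%N ->
  mode u (g * klein i)%g = ceval (mode^~ g) (klein_ract i u).
Proof.
move=> i4; have [l [k _ ->]] := word_surj hab g.
rewrite klein_word // (wordM hab) ceval1 geval_sign !mode_word /=.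
rewrite mulrCA; congr (_ * _); first by case: l (1 < i)%N u.2 => [] [] [].
rewrite mulnDr exprD epsilon_4M mulrC; congr (_ * _).
case: ifP => // _.
rewrite -(eighth_root_mod eps4) -[in RHS](eighth_root_mod eps4) modnMml.
by rewrite mulnCA mulnA.
Qed.

Definition klein_twist : KK :=
  \sum_(i < 4) \sum_(j < 4)
    (8^-1 * geval C (nth (gz 0) (nth [::] omega_table i) j)) *:
      gtensor (lambda C (klein i)) (lambda C (klein j)).

Definition twisted_coproduct (x : K) : KK :=
  klein_twist * group_coproduct x * gstar klein_twist.

Local Notation Delta := twisted_coproduct.

Definition mode_tensor (v : mono * mono) : gT * gT -> C :=
  ftensor (mode v.1) (mode v.2).

Lemma ev_omegaM (F : gT * gT -> C) X :
  ev F (klein_twist * X) = 8^-1 * \sum_(i < 4) \sum_(j < 4)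
    geval C (nth (gz 0) (nth [::] omega_table i) j) *
    ev (fun v => F (klein i * v.1, klein j * v.2)%g) X.
Proof.
rewrite /klein_twist mulr_suml ev_sum mulr_sumr; apply: eq_bigr => i _.
rewrite mulr_suml ev_sum mulr_sumr; apply: eq_bigr => j _.
rewrite -gscalerAl evZ gtensor_lambda ev_lambdaM mulrA.
by congr (_ * _); apply: eq_ev => -[].
Qed.

Lemma ev_Momega (F : gT * gT -> C) X :
  ev F (X * gstar klein_twist) = 8^-1 * \sum_(i < 4) \sum_(j < 4)
    geval C (gconj (nth (gz 0) (nth [::] omega_table i) j)) *
    ev (fun v => F (v.1 * klein i, v.2 * klein j)%g) X.
Proof.
rewrite /klein_twist gstar_sum mulr_sumr ev_sum mulr_sumr; apply: eq_bigr => i _.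
rewrite gstar_sum mulr_sumr ev_sum mulr_sumr; apply: eq_bigr => j _.
rewrite gstarZ -gscalerAr evZ gtensor_lambda gstar_lambda ev_Mlambda.
rewrite rmorphM fmorphV rmorph_nat /= -geval_conj mulrA; congr (_ * _).
apply: eq_ev => -[g h]; congr F.
by rewrite -[LHS]/(g * (klein i)^-1, h * (klein j)^-1)%g !klein_inv.
Qed.

Lemma ceval_mode_tensor c d v :
  ceval (mode_tensor^~ v) (cprod c d) = ceval (mode^~ v.1) c * ceval (mode^~ v.2) d.
Proof.
rewrite ceval_prod ceval_mulr; apply: eq_ceval => m.
by rewrite ceval_mull.
Qed.

(** Left multiplication by [Omega] is transposed to an action on functionals, so
    that the coproduct can be computed on formal combinations; likewise on the
    right. *)
Lemma ev_omega_lact c X :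
  ev (fun v => ceval (mode_tensor^~ v) c) (klein_twist * X) =
  8^-1 * ev (fun v => ceval (mode_tensor^~ v) (csubst omega_lact c)) X.
Proof.
rewrite ev_omegaM; congr (_ * _); under eq_bigr => i _ do
  (under eq_bigr => j _ do rewrite -ev_fscale; rewrite -ev_fsum).
rewrite -ev_fsum; apply: eq_ev => v; rewrite ceval_subst.
under [RHS]eq_ceval => u do rewrite ceval_omega.
rewrite ceval_sum; apply: eq_bigr => i _; rewrite ceval_sum; apply: eq_bigr => j _.
rewrite ceval_mull; apply: eq_ceval => u.
by rewrite ceval_scale ceval_mode_tensor -!klein_lactE.
Qed.

Lemma ev_omega_ract c X :
  ev (fun v => ceval (mode_tensor^~ v) c) (X * gstar klein_twist) =
  8^-1 * ev (fun v => ceval (mode_tensor^~ v) (csubst omega_ract c)) X.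
Proof.
rewrite ev_Momega; congr (_ * _); under eq_bigr => i _ do
  (under eq_bigr => j _ do rewrite -ev_fscale; rewrite -ev_fsum).
rewrite -ev_fsum; apply: eq_ev => v; rewrite ceval_subst.
under [RHS]eq_ceval => u do rewrite ceval_omega.
rewrite ceval_sum; apply: eq_bigr => i _; rewrite ceval_sum; apply: eq_bigr => j _.
rewrite ceval_mull; apply: eq_ceval => u.
by rewrite ceval_scale ceval_mode_tensor -!klein_ractE.
Qed.

Lemma pointwiseE u g : mode_tensor u (g, g) = ceval (mode^~ g) (pointwise u).
Proof.
have [l [k _ ->]] := word_surj hab g.
rewrite /mode_tensor /ftensor /pointwise !mode_word /=.
case: (u.1.2 =P u.2.2) => [<-|ne].
  rewrite ceval1 geval1 mul1r mode_word /= mulrACA -exprD -mulnDl.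
  rewrite -natrM mulnb andbb.
  by rewrite -(eighth_root_mod eps4 (_ %% 8 * k)) modnMml (eighth_root_mod eps4).
rewrite ceval_nil mulrACA -natrM mulnb (_ : _ && _ = false) ?mul0r //.
by apply/negP => /andP[/eqP lu /eqP lv]; case: ne; rewrite -lu.
Qed.

Lemma ev_twisted c x :
  ev (fun v => ceval (mode_tensor^~ v) c) (Delta x) =
  64^-1 * ev (fun g => ceval (mode^~ g) (twisted c)) x.
Proof.
rewrite /twisted_coproduct -mulrA ev_omega_lact.
under eq_ev => v do rewrite -(ceval_norm _ (csubst _ _)).
rewrite ev_omega_ract mulrA -invfM -natrM; congr (_ * _).
rewrite ev_group_coproduct; apply: eq_ev => g.
rewrite /twisted [RHS]ceval_subst -(ceval_norm _ (csubst _ _)).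
by apply: eq_ceval => u; rewrite pointwiseE.
Qed.

(** ** The coordinates *)

Definition pauli_fun (i : nat) (g : gT) : C := ceval (mode^~ g) (pauli i).

Definition crd (i : nat) (x : K) : C := ev (pauli_fun i) x.

Lemma all_iotaP (P : pred nat) n : all P (iota 0 n) -> forall i, (i < n)%N -> P i.
Proof. by move=> /allP h i i_n; apply: h; rewrite mem_iota. Qed.

(** The fusion table is the multiplication of the dual algebra. *)
Lemma crd_coproduct i j x : (i < 16)%N -> (j < 16)%N ->
  ev (ftensor (pauli_fun i) (pauli_fun j)) (Delta x) = ceval (crd^~ x) (dmul i j).
Proof.
move=> i16 j16.
transitivity
  (ev (fun v => ceval (mode_tensor^~ v) (cprod (pauli i) (pauli j))) (Delta x)).
  by apply: eq_ev => v; rewrite ceval_mode_tensor.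
rewrite ev_twisted.
have tw := all_iotaP (all_iotaP fusion_table_twisted i16) j16.
under eq_ev => g do rewrite (ceqP _ tw) ceval_scale ceval_subst.
rewrite ev_fscale /geval /zeval /= mulr0 addr0 mulrA mulVf ?mul1r; last first.
  by rewrite (pnatr_eq0 _ 64).
by rewrite ev_ceval.
Qed.

(** ** Structure maps in coordinates *)

Lemma ev_mul (F : gT -> C) (x y : K) :
  ev F (x * y) = \sum_g \sum_h F (g * h)%g * (gcoef x g * gcoef y h).
Proof.
rewrite {1}(lambda_sum x) mulr_suml ev_sum; apply: eq_bigr => g _.
rewrite -gscalerAl evZ ev_lambdaM /ev mulr_sumr; apply: eq_bigr => h _.
by rewrite mulrCA.
Qed.

Lemma mono_copE u g h :
  mode u (g * h)%g = ceval (fun v => mode v.1 g * mode v.2 h) (mono_cop u).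
Proof.
have [l [k _ ->]] := word_surj hab g; have [l' [k' _ ->]] := word_surj hab h.
rewrite (wordM hab) /mono_cop ceval_cons ceval1 geval1 !mul1r !mode_word /=.
case: u => m c; case: l' => /=; rewrite mulnDr exprD.
  rewrite mul0r mulr0 add0r mul1r mulrA; congr (_ * _ * _).
    by case: l c => [] [].
  rewrite -(eighth_root_mod eps4 (_ %% 8 * k)) modnMml (eighth_root_mod eps4).
  by rewrite mulnCA mulnA.
by rewrite mul0r mulr0 addr0 mul1r addbF mulrA.
Qed.

Lemma crd_mul i x y : (i < 16)%N ->
  2 * crd i (x * y) = ceval (fun v => crd v.1 x * crd v.2 y) (cop i).
Proof.
move=> i16; have tab := all_iotaP cop_pauli i16.
have pfunM g h : 2 * pauli_fun i (g * h)%g =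
    ceval (fun v => pauli_fun v.1 g * pauli_fun v.2 h) (cop i).
  transitivity (ceval (fun v => mode v.1 g * mode v.2 h)
                  (cscale (gz 2) (csubst mono_cop (pauli i)))).
    rewrite ceval_scale [geval _ _](_ : _ = 2); last first.
      by rewrite /geval /zeval mulr0 addr0.
    by rewrite ceval_subst; congr (_ * _); apply: eq_ceval => u; rewrite mono_copE.
  rewrite (ceqP _ tab) ceval_subst; apply: eq_ceval => v.
  exact: (ceval_mode_tensor _ _ (g, h)).
rewrite /crd ev_mul mulr_sumr.
under eq_bigr => g _.
  rewrite mulr_sumr; under eq_bigr => h _ do rewrite mulrA pfunM ceval_mulr.
  rewrite -(ceval_sum _ (cop i)); over.
rewrite -(ceval_sum _ (cop i)); apply: eq_ceval => v.
rewrite /ev mulr_suml; apply: eq_bigr => g _; rewrite mulr_sumr.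
by apply: eq_bigr => h _; rewrite mulrACA.
Qed.

Lemma pfun_conj i g : (i < 16)%N -> pauli_fun i g^-1%g = (pauli_fun i g)^*.
Proof.
move=> i16; rewrite /pauli_fun -(ceqP _ (all_iotaP pauli_conj i16)) /ceval big_map.
rewrite rmorph_sum; apply: eq_bigr => t _; rewrite rmorphM /= geval_conj.
congr (_ * _); case: t => _ [m c] /=.
have [l [k _ ->]] := word_surj hab g.
rewrite (word_inv hab) !mode_word rmorphM rmorph_nat /= (eighth_root_conj eps4).
case: eqP => [<-|]; rewrite ?mul0r //; congr (_ * _).
case: l; last by rewrite mulnCA.
rewrite -(eighth_root_mod eps4 (_ %% 8 * k)) modnMml (eighth_root_mod eps4).
by rewrite mulnA.
Qed.

Lemma crd_star i x : (i < 16)%N -> crd i (gstar x) = (crd i x)^*.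
Proof.
move=> i16; rewrite /crd /ev rmorph_sum (reindex_inj invg_inj) /=.
apply: eq_bigr => g _; rewrite gcoef_star invgK rmorphM /=.
by rewrite pfun_conj.
Qed.

Lemma crd0 x : crd 0 x = counit x.
Proof.
rewrite counit_ev; apply: eq_ev => g; have [l [k _ ->]] := word_surj hab g.
rewrite /pauli_fun ceval_cons ceval1 !mode_word !mul0n !expr0 !geval1 !mul1r !mulr1.
by case: l; rewrite ?addr0 ?add0r.
Qed.

Lemma crd_one i : (i < 16)%N -> crd i 1 = geval C (at_one i).
Proof.
move=> i16; have := ceqP (fun=> 1 : C) (all_iotaP pauli_one i16).
rewrite ceval1 mulr1 => <-; rewrite /crd ev_lambda /pauli_fun.
have -> : 1%g = word false 0 by rewrite /word mul1g.
rewrite /ceval big_map big_filter [RHS]big_mkcond; apply: eq_bigr => t _.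
by rewrite mode_word muln0 expr0 mulr1; case: t.2.2; rewrite /= ?mulr0 ?mulr1.
Qed.

(** Orthogonality of the coordinate functions; it gives both the inversion formula
    [crd_inj] and the recovery of [Delta x] from its slices. *)
Lemma casimirE g h :
  ceval (fun i => pauli_fun i g * pauli_fun i h) casimir = (g == h)%:R * 16.
Proof.
transitivity (ceval (mode_tensor^~ (g, h)) mono_casimir).
  rewrite -(ceqP _ casimir_mono) ceval_subst; apply: eq_ceval => i.
  by rewrite ceval_mode_tensor.
have [l [k k8 ->]] := word_surj hab g; have [l' [k' k8' ->]] := word_surj hab h.
rewrite (word_eq hab) // /ceval big_allpairs_dep.
transitivity (\sum_(m <- iota 0 8) \sum_(c <- [:: false; true])
   2 * ((l == c)%:R * (l' == c)%:R) * eps ^+ ((k + 7 * k') * m)).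
  apply: eq_bigr => m _; apply: eq_bigr => c _.
  rewrite /mode_tensor /ftensor /= !mode_word /= mulrACA -[RHS]mulrA.
  congr (_ * (_ * _)).
    by rewrite /geval /zeval mulr0 addr0.
  rewrite -(eighth_root_mod eps4 (_ %% 8 * _)) modnMml (eighth_root_mod eps4).
  rewrite -exprD mulnDl.
  by rewrite mulnC; congr (_ ^+ (_ + _)); rewrite mulnAC.
rewrite exchange_big.
under eq_bigr => c _ do
  rewrite -mulr_sumr -[iota 0 8]/(index_iota 0 8) big_mkord (eighth_root_sum eps4).
have -> : ((k + 7 * k') %% 8 == 0)%N = (k == k').
  have tab : all (fun i => all (fun j => ((i + 7 * j) %% 8 == 0)%N == (i == j))
                              (iota 0 8)) (iota 0 8) by [].
  by have := all_iotaP (all_iotaP tab k8) k8' => /= /eqP.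
rewrite -mulr_suml -mulr_sumr !big_cons big_nil addr0.
case: (k == k'); last by rewrite andbF mulr0 mul0r.
rewrite andbT; case: l l' {k k' k8 k8'} => [] [] /=; ring.
Qed.

Lemma crd_inj (x y : K) : (forall i, (i < 16)%N -> crd i x = crd i y) -> x = y.
Proof.
move=> exy; apply: gcoefP => h.
have gE z : 16 * gcoef z h = ceval (fun i => crd i z * pauli_fun i h) casimir.
  rewrite gcoef_ev -ev_fscale.
  under eq_ev => g do rewrite mulrC -casimirE.
  rewrite ev_ceval; apply: eq_ceval => i; rewrite mulrC -ev_fscale.
  by apply: eq_ev => g; rewrite mulrC.
have n16 : (16 : C) != 0 by rewrite (pnatr_eq0 _ 16).
apply: (mulfI n16); rewrite !gE /ceval !big_map big_seq [RHS]big_seq.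
by apply: eq_bigr => i; rewrite mem_iota => /exy ->.
Qed.

(** ** Slices of the coproduct *)

Definition lslice (i : nat) (x : K) : K := slice (pauli_fun i) (Delta x).

Lemma crd_lslice i j x : (i < 16)%N -> (j < 16)%N ->
  crd j (lslice i x) = ceval (crd^~ x) (dmul i j).
Proof. by move=> i16 j16; rewrite /crd ev_slice crd_coproduct. Qed.

(** The slices by the coordinates determine the coefficients of [Delta x] on
    every [lambda g], so a coideal can be tested on the 16 maps [lslice i]. *)
Lemma right_leg_lslice g x :
  16 *: right_leg g (Delta x) =
  \sum_(i <- iota 0 16) (geval C (eta i) * pauli_fun i g) *: lslice i x.
Proof.
transitivity (\sum_h ((h == g)%:R * 16 : C) *: right_leg h (Delta x)).
  rewrite (bigD1 g) //= eqxx mul1r big1 ?addr0 // => h /negbTE->.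
  by rewrite mul0r scale0r.
under eq_bigr => h _ do rewrite -casimirE /ceval big_map scaler_suml.
rewrite exchange_big /=; apply: eq_bigr => i _.
rewrite /lslice slice_right_leg scaler_sumr; apply: eq_bigr => h _.
by rewrite scalerA mulrAC mulrA.
Qed.

Lemma coproduct_tensorvP (I : {vspace K}) x :
  (Delta x \in tensorv fullv I) <-> (forall i, (i < 16)%N -> lslice i x \in I).
Proof.
split=> [/tensorv_fullP DI i _ | LI].
  by rewrite /lslice slice_right_leg memv_suml // => g _; apply/memvZ/DI.
apply/tensorv_fullP => g; have n16 : (16 : C) != 0 by rewrite (pnatr_eq0 _ 16).
rewrite -[right_leg _ _]scale1r -(mulVf n16) -scalerA right_leg_lslice memvZ //.
rewrite big_seq memv_suml //.
by move=> i; rewrite mem_iota => /LI; apply: memvZ.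
Qed.

End DualBasis.

(** Both sides are the trace of the identity of [V]. *)
Lemma dim_reproducing (F : fieldType) (vT : vectType F) (n : nat)
    (V : {vspace vT}) (v : 'I_n -> vT) (phi : 'I_n -> 'Hom(vT, F^o)) :
  (forall i, v i \in V) -> {in V, forall y, \sum_i (phi i y : F) *: v i = y} ->
  (\dim V)%:R = \sum_i (phi i (v i) : F).
Proof.
move=> vV repr.
transitivity (\sum_(k < \dim V) coord (vbasis V) k (vbasis V)`_k).
  rewrite (eq_bigr (fun=> 1)) ?sumr_const ?card_ord // => k _.
  by rewrite coord_free ?eqxx // (basis_free (vbasisP V)).
have XV (k : 'I_(\dim V)) : (vbasis V)`_k \in V.
  by rewrite vbasis_mem // mem_nth // size_tuple.
under eq_bigr => k _ do rewrite -{1}(repr _ (XV k)) linear_sum.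
rewrite exchange_big /=; apply: eq_bigr => i _.
rewrite [in RHS](coord_vbasis (vV i)) linear_sum; apply: eq_bigr => k _.
by rewrite !linearZ /= mulrC.
Qed.

Lemma span_ind (F : fieldType) (vT : vectType F) (X : seq vT) (P : vT -> Prop) :
  P 0 -> (forall k y z, P y -> P z -> P (k *: y + z)) ->
  {in X, forall x, P x} -> {in <<X>>%VS, forall y, P y}.
Proof.
move=> P0 Plin; elim: X => [|x X IH] PX y.
  by rewrite span_nil memv0 => /eqP->.
rewrite span_cons => /memv_addP[_ /vlineP[k ->] [z zX ->]].
apply: Plin; first by apply: PX; rewrite mem_head.
by apply: IH zX => u uX; apply: PX; rewrite inE uX orbT.
Qed.

Lemma eq_in_ceval (C : numClosedFieldType) M (v w : M -> C) (c : comb M)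
    (P : pred M) :
  all (fun t => P t.2) c -> (forall m, P m -> v m = w m) ->
  ceval v c = ceval w c.
Proof.
move=> + vw; elim: c => [|t c IH] /=; first by rewrite !ceval_nil.
by move=> /andP[Pt Pc]; rewrite !ceval_cons vw // IH.
Qed.

Lemma eq_ceval16 (C : numClosedFieldType) (v w : nat -> C) (c : comb nat) :
  all (fun t => (t.2 < 16)%N) c ->
  (forall m, (m < 16)%N -> v m = w m) -> ceval v c = ceval w c.
Proof. exact: (@eq_in_ceval C nat v w c (fun m => m < 16)%N). Qed.

Lemma eq_ceval_pair16 (C : numClosedFieldType) (v w : nat * nat -> C)
    (c : comb (nat * nat)) :
  all (fun t => (t.2.1 < 16) && (t.2.2 < 16))%N c ->
  (forall i j, (i < 16)%N -> (j < 16)%N -> v (i, j) = w (i, j)) ->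
  ceval v c = ceval w c.
Proof.
move=> c16 vw.
apply: (@eq_in_ceval C _ v w c (fun u => (u.1 < 16) && (u.2 < 16))%N c16).
by move=> [i j] /andP[]; apply: vw.
Qed.

(** * Coideal subalgebras and their projections *)

Section Coideals.
Variables (C : numClosedFieldType) (eps : C) (gT : finGroupType) (a b : gT).
Hypothesis eps4 : eps ^+ 4 = -1.
Hypothesis hab : dihedral_generators 4 a b.
Local Notation K := (group_algebra C gT).
Local Notation Delta := (@twisted_coproduct C gT a b).
Local Notation crd := (@crd C eps gT a b).
Local Notation L := (@lslice C eps gT a b).
Implicit Types (x y p q : K) (I : {vspace K}).

Lemma dmul_lt16 i j : (i < 16)%N -> (j < 16)%N ->
  all (fun t => (t.2 < 16)%N) (dmul i j).
Proof. by move=> i16; apply: (all_iotaP (all_iotaP dmul_bound i16)). Qed.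

Lemma cop_lt16 i : (i < 16)%N ->
  all (fun t => (t.2.1 < 16) && (t.2.2 < 16))%N (cop i).
Proof. exact: (all_iotaP cop_bound). Qed.

Lemma crd_linear i : linear (crd i : K -> C^o).
Proof. exact: ev_linear. Qed.

HB.instance Definition _ i := GRing.isLinear.Build C K C^o _ (crd i) (crd_linear i).

Lemma crdZ i k x : crd i (k *: x) = k * crd i x.
Proof. exact: evZ. Qed.

Lemma lslice_linear i : linear (L i).
Proof.
have gc_linear : linear (@group_coproduct C gT).
  move=> k x y; apply: gcoefP => u; rewrite gcoefD gcoefZ !gcoef_ev.
  by rewrite !ev_group_coproduct evD evZ.
move=> k x y; rewrite /lslice /twisted_coproduct gc_linear mulrDr mulrDl.
by rewrite -gscalerAr -gscalerAl linearP.
Qed.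

HB.instance Definition _ i := GRing.isLinear.Build C K K _ (L i) (lslice_linear i).

Definition vcomb (v : nat -> K) (c : comb nat) : K :=
  \sum_(t <- c) geval C t.1 *: v t.2.

Lemma crd_vcomb j v c : crd j (vcomb v c) = ceval (fun m => crd j (v m)) c.
Proof. by rewrite linear_sum; apply: eq_bigr => t _; rewrite linearZ. Qed.

Lemma lslice0 x : L 0 x = x.
Proof.
apply: (crd_inj eps4 hab) => j j16; rewrite (crd_lslice eps4 hab) //.
have /andP[u _] := all_iotaP dmul_unit j16.
by rewrite (ceqP _ u) ceval1 geval1 mul1r.
Qed.

Lemma counit_lslice i x : (i < 16)%N -> counit (L i x) = crd i x.
Proof.
move=> i16; rewrite -(crd0 eps4 hab) (crd_lslice eps4 hab) //.
have /andP[_ u] := all_iotaP dmul_unit i16.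
by rewrite (ceqP _ u) ceval1 geval1 mul1r.
Qed.

(** Coassociativity: the slices [L_i] are an action of the dual algebra. *)
Lemma lslice_lslice i j x : (i < 16)%N -> (j < 16)%N ->
  L j (L i x) = vcomb (L^~ x) (dmul i j).
Proof.
move=> i16 j16; apply: (crd_inj eps4 hab) => k k16.
rewrite (crd_lslice eps4 hab) // crd_vcomb.
have assoc := all_iotaP (all_iotaP (all_iotaP dmul_assoc i16) j16) k16.
transitivity (ceval (crd^~ x) (csubst (dmul i) (dmul j k))).
  rewrite ceval_subst; apply: (eq_ceval16 (dmul_lt16 j16 k16)) => m m16.
  by rewrite (crd_lslice eps4 hab).
rewrite -(ceqP _ assoc) ceval_subst; apply: (eq_ceval16 (dmul_lt16 i16 j16)).
by move=> m m16; rewrite (crd_lslice eps4 hab).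
Qed.

Lemma lslice1 i : (i < 16)%N -> L i 1 = crd i 1 *: 1.
Proof.
move=> i16; apply: (crd_inj eps4 hab) => j j16.
rewrite (crd_lslice eps4 hab) // crdZ.
have tab := ceqP (fun=> 1 : C) (all_iotaP (all_iotaP dmul_one i16) j16).
rewrite ceval1 mulr1 gevalM -!(crd_one eps4 hab) // in tab.
rewrite -{}tab /ceval [RHS]big_map.
rewrite big_seq [RHS]big_seq; apply: eq_bigr => t tD.
rewrite mulr1 gevalM (crd_one eps4 hab) //.
exact: (allP (dmul_lt16 i16 j16)).
Qed.

(** Multiplicativity of the coproduct, with [cop] expanding the coordinate of a
    product on the left leg. *)
Lemma lslice_mul i x y : (i < 16)%N ->
  2 *: L i (x * y) =
  \sum_(t <- cop i) geval C t.1 *: (L t.2.1 x * L t.2.2 y).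
Proof.
move=> i16; apply: (crd_inj eps4 hab) => j j16.
have g2 : geval C (gz 2) = 2 by rewrite /geval /zeval mulr0 addr0.
apply: (mulfI (two_neq0 C)); rewrite linear_sum crdZ (crd_lslice eps4 hab) //.
pose B (v : nat * nat) := crd v.1 x * crd v.2 y.
have tab := ceqP B (all_iotaP (all_iotaP dmul_mult i16) j16).
transitivity (ceval B (cscale (gz 2) (csubst cop (dmul i j)))).
  rewrite ceval_scale g2 ceval_subst; congr (_ * _); rewrite ceval_mull.
  apply: (eq_ceval16 (dmul_lt16 i16 j16)) => m m16.
  by rewrite (crd_mul eps4 hab).
rewrite {}tab ceval_subst ceval_prod mulr_sumr /ceval big_seq [RHS]big_seq.
apply: eq_bigr => t tC /=; rewrite linearZ /= mulrCA (crd_mul eps4 hab) //.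
have /andP[t1 t2] := allP (cop_lt16 i16) _ tC.
congr (_ * _).
rewrite -[LHS]/(ceval (fun v => ceval B (cprod (dmul t.2.1 v.1) (dmul t.2.2 v.2)))
                  (cop j)).
apply: (eq_ceval_pair16 (cop_lt16 j16)) => c d c16 d16.
rewrite ceval_prod !(crd_lslice eps4 hab) // ceval_mulr; apply: eq_ceval => m.
by rewrite ceval_mull.
Qed.

Lemma lslice_star i x : (i < 16)%N -> gstar (L i x) = L i (gstar x).
Proof.
move=> i16; apply: (crd_inj eps4 hab) => j j16.
rewrite (crd_star eps4 hab) // !(crd_lslice eps4 hab) // /ceval rmorph_sum.
rewrite big_seq [RHS]big_seq; apply: eq_bigr => t tD.
rewrite rmorphM /= -(crd_star eps4 hab); last exact: (allP (dmul_lt16 i16 j16)).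
by case/mapP: tD => z _ ->; rewrite -geval_conj.
Qed.

(** 16 times the value of the Haar trace. *)
Definition weight (p : K) : C := ceval (crd^~ p) mass.

(** This identity recovers [y] from the products [L_i y * p]. When [p] absorbs
    [y], these are multiples of [p], and so [y] lies in the span of the slices of
    [p]. *)
Lemma lslice_casimir y p :
  vcomb (fun i => L i (L i y * p)) casimir = weight p *: y.
Proof.
apply: (crd_inj eps4 hab) => j j16; rewrite crd_vcomb crdZ.
have g2 : geval C (gz 2) = 2 by rewrite /geval /zeval mulr0 addr0.
apply: (mulfI (two_neq0 C)); pose B (v : nat * nat) := crd v.1 y * crd v.2 p.
have cas16 : all (fun t => (t.2 < 16)%N) casimir by [].
transitivity (ceval B (cscale (gz 2) (cprod [:: (gz 1, j)] mass))).
  rewrite -(ceqP _ (all_iotaP casimir_reproducing j16)) ceval_subst ceval_mull.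
  apply: (eq_ceval16 cas16) => i i16.
  rewrite (crd_lslice eps4 hab) // ceval_subst ceval_mull.
  apply: (eq_ceval16 (dmul_lt16 i16 j16)) => k k16.
  rewrite (crd_mul eps4 hab) // ceval_subst.
  apply: (eq_ceval_pair16 (cop_lt16 k16)) => c d c16 d16.
  rewrite ceval_prod (crd_lslice eps4 hab) // ceval_mulr; apply: eq_ceval => m.
  by rewrite ceval1 geval1 mul1r.
rewrite ceval_scale g2 ceval_prod ceval1 geval1 mul1r /weight ceval_mulr.
by congr (_ * _); apply: eq_ceval => m; apply: mulrC.
Qed.

(** The sum of the products [eta_i f_i f_i] in the dual algebra is 16 times its
    unit, the counit of [K]. *)
Lemma trace_casimir p : ceval (fun i => crd i (L i p)) casimir = 16 * counit p.
Proof.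
transitivity (ceval (crd^~ p) [:: (gz 16, 0%N)]); last first.
  by rewrite ceval1 (crd0 eps4 hab) /geval /zeval mulr0 addr0.
rewrite -(ceqP _ casimir_trace) ceval_subst.
by apply: eq_ceval16 => // i i16; rewrite (crd_lslice eps4 hab).
Qed.

(** ** The coideal subalgebra of a projection *)

(** The equation [Delta(y) (1 (x) p) = y (x) p]. *)
Definition absorbs p y := forall i, (i < 16)%N -> L i y * p = crd i y *: p.

Definition coideal_of p : {vspace K} := <<[seq L i p | i <- iota 0 16]>>%VS.

Lemma lslice_coideal_of i p : (i < 16)%N -> L i p \in coideal_of p.
Proof. by move=> i16; apply/memv_span/mapP; exists i; rewrite ?mem_iota. Qed.

Lemma absorbs_mem p y : weight p != 0 -> absorbs p y -> y \in coideal_of p.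
Proof.
move=> w0 py; rewrite -[y]scale1r -(mulVf w0) -scalerA -lslice_casimir memvZ //.
rewrite /vcomb big_map big_seq memv_suml // => i; rewrite mem_iota => i16.
by rewrite memvZ // py // linearZ memvZ // lslice_coideal_of.
Qed.

Lemma absorbs_linear p k y z : absorbs p y -> absorbs p z -> absorbs p (k *: y + z).
Proof.
move=> py pz i i16; rewrite (linearP (L i)) mulrDl -gscalerAl py // pz //.
by rewrite /crd evD evZ scalerDl scalerA.
Qed.

Lemma absorbs0 p : absorbs p 0.
Proof. by move=> i _; rewrite !linear0 mul0r scale0r. Qed.

Lemma absorbs_lslice p y i : (i < 16)%N -> absorbs p y -> absorbs p (L i y).
Proof.
move=> i16 py j j16; rewrite lslice_lslice // /vcomb mulr_suml.
rewrite (crd_lslice eps4 hab) //.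
rewrite /ceval scaler_suml big_seq [RHS]big_seq; apply: eq_bigr => t tD.
by rewrite -gscalerAl py ?scalerA // (allP (dmul_lt16 i16 j16)).
Qed.

Lemma absorbs1 p : absorbs p 1.
Proof. by move=> i i16; rewrite lslice1 // -gscalerAl mul1r. Qed.

(** [Delta(x) Delta(y) (1 (x) p) = Delta(x) (y (x) p) = x y (x) p]. *)
Lemma absorbsM p x y : absorbs p x -> absorbs p y -> absorbs p (x * y).
Proof.
move=> px py i i16; apply: (scalerI (two_neq0 C)).
rewrite gscalerAl lslice_mul // scalerA (crd_mul eps4 hab) //.
rewrite mulr_suml /ceval scaler_suml big_seq [RHS]big_seq; apply: eq_bigr => t tC.
have /andP[t1 t2] := allP (cop_lt16 i16) _ tC.
rewrite -gscalerAl -mulrA (py _ t2) -gscalerAr (px _ t1) !scalerA.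
by rewrite mulrAC mulrA.
Qed.

Lemma absorbs_counit p y : absorbs p y -> y * p = counit y *: p.
Proof. by move=> py; rewrite -(crd0 eps4 hab) -py // lslice0. Qed.

Lemma mem_absorbs p y : absorbs p p -> y \in coideal_of p -> absorbs p y.
Proof.
move=> pp; move: y; apply: span_ind; [exact: absorbs0 | exact: absorbs_linear |].
by move=> _ /mapP[i i16 ->]; rewrite mem_iota in i16; apply: absorbs_lslice.
Qed.

(** These identities characterize the Jones projections of coideal subalgebras
    among the elements of [K]. *)
Definition coideal_projection p :=
  [/\ is_projection p, counit p = 1, absorbs p p & weight p != 0].

Lemma coideal_ofP p y : coideal_projection p ->
  (y \in coideal_of p) <-> absorbs p y.
Proof. by case=> _ _ pp w0; split; [apply: mem_absorbs | apply: absorbs_mem]. Qed.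

(** Being the set of the elements that [p] absorbs, [coideal_of p] is an algebra
    stable under slices; being spanned by the slices of the self-adjoint [p], it
    is stable under the star. *)
Lemma coideal_of_coideal p : coideal_projection p ->
  coideal_subalgebra Delta (coideal_of p).
Proof.
move=> /[dup] pJ [[ps _] _ pp w0]; split.
- by apply/coideal_ofP => //; apply: absorbs1.
- move=> x y /coideal_ofP px /coideal_ofP py; apply/coideal_ofP => //.
  by apply: absorbsM; [apply: px | apply: py].
- apply: span_ind => [||_ /mapP[i i16 ->]].
  + by rewrite -(scale0r 0) gstarZ rmorph0 scale0r mem0v.
  + by move=> k y z yI zI; rewrite gstarD gstarZ memvD ?memvZ.
  + by rewrite mem_iota in i16; rewrite lslice_star // ps lslice_coideal_of.
- move=> x /coideal_ofP px; apply/(coproduct_tensorvP eps4 hab) => i i16.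
  by apply/coideal_ofP => //; apply: absorbs_lslice => //; apply: px.
Qed.

Lemma coideal_projection_neq0 p : coideal_projection p -> p != 0.
Proof.
case=> _ e1 _ _; apply/eqP => p0; move: e1 => /eqP.
by rewrite p0 -(crd0 eps4 hab) linear0 eq_sym oner_eq0.
Qed.

Lemma coideal_of_jones p : coideal_projection p ->
  jones_projection (coideal_of p) p.
Proof.
move=> /[dup] pJ [pproj _ pp _]; apply: jones_projectionI => //.
- exact/coideal_ofP.
- exact: coideal_projection_neq0.
- by move=> y /coideal_ofP py; apply: absorbs_counit; apply: py.
Qed.

(** On [coideal_of p] the reproducing identity reads
    [\sum_i eta_i crd_i(y) L_i p = weight p *: y], so the dimension is
    [\sum_i eta_i crd_i(L_i p) / weight p], which is [16 counit(p) / weight p]. *)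
Lemma dim_coideal_of p : coideal_projection p ->
  (\dim (coideal_of p))%:R = 16 / weight p.
Proof.
move=> /[dup] pJ [_ e1 pp w0].
pose phi (i : 'I_16) : 'Hom(K, C^o) :=
  (geval C (eta i) / weight p) *: linfun (crd i : K -> C^o).
rewrite (@dim_reproducing _ _ 16 _ (fun i => L i p) phi).
- have := trace_casimir p; rewrite e1 mulr1 => <-.
  rewrite /ceval big_map -[iota 0 16]/(index_iota 0 16) big_mkord mulr_suml.
  by apply: eq_bigr => i _; rewrite scale_lfunE lfunE; apply: mulrAC.
- by move=> i; apply: lslice_coideal_of.
- move=> y /(mem_absorbs pp) py; rewrite -[RHS]scale1r -(mulVf w0) -scalerA.
  rewrite -lslice_casimir /vcomb big_map -[iota 0 16]/(index_iota 0 16) big_mkord.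
  rewrite scaler_sumr; apply: eq_bigr => i _; rewrite scale_lfunE lfunE /= py //.
  have -> : L i (crd i y *: p) = crd i y *: L i p by exact: linearZ.
  by rewrite !scalerA mulrA [_^-1 * geval _ _]mulrC.
Qed.

(** If [p q = q], then multiplying [L_i y * p = crd_i y *: p] by [q] on the right
    shows that [q] absorbs what [p] absorbs; conversely, a [p] in [coideal_of q]
    acts on [q] by its counit. *)
Lemma coideal_of_le p q : coideal_projection p -> coideal_projection q ->
  (coideal_of p <= coideal_of q)%VS <-> p * q = q.
Proof.
move=> pJ qJ; split=> [pq | pq].
  have pV : p \in coideal_of q.
    by apply: (subvP pq); apply/coideal_ofP => //; case: pJ.
  rewrite (absorbs_counit ((coideal_ofP p qJ).1 pV)).
  by case: pJ => _ -> _ _; rewrite scale1r.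
apply/subvP => y /coideal_ofP py; apply/coideal_ofP => // i i16.
by rewrite -pq mulrA py // gscalerAl.
Qed.

Lemma coideal_absorbs I p :
  coideal_subalgebra Delta I -> {in I, forall y, y * p = counit y *: p} ->
  {in I, forall y, absorbs p y}.
Proof.
move=> [_ _ _ ID] pE y yI i i16; rewrite pE ?counit_lslice //.
by have /(coproduct_tensorvP eps4 hab) := ID y yI; apply.
Qed.

Lemma coideal_eq I p :
  coideal_subalgebra Delta I -> p \in I ->
  {in I, forall y, y * p = counit y *: p} -> coideal_projection p ->
  I = coideal_of p.
Proof.
move=> Ico pI pE pJ; apply/eqP; rewrite eqEsubv; apply/andP; split.
  apply/subvP => y yI; apply/coideal_ofP => //.
  exact: (coideal_absorbs Ico pE).
apply/span_subvP => _ /mapP[i i16 ->]; rewrite mem_iota in i16.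
have Dp : Delta p \in tensorv fullv I by case: Ico => _ _ _; apply.
exact: (coproduct_tensorvP eps4 hab I p).1 Dp i i16.
Qed.

End Coideals.

(** * The solutions of the quadratic equations *)

(** Twice the coordinate [j] of [L_i p * p], a quadratic form in the coordinates
    of [p]. *)
Definition jones_comb (i j : nat) : comb (nat * nat) :=
  csubst (fun v => cprod (dmul i v.1) [:: (gz 1, v.2)]) (cop j).

Local Open Scope Z_scope.

(** The coordinates of the listed projections. Each block of four is twice a
    projection of rank 0, 1 or 2: [0; 0; 0; 0], [1; u; v; w] with unit vector
    [(u, v, w)], or [2; 0; 0; 0]. *)
Definition label_coords (l : KD4_label) : seq Z :=
  match l with
  | I0 => [:: 1; 1; 1; 1;   0; 0; 0; 0;   2; 0; 0; 0;   0; 0; 0; 0]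
  | I1 => [:: 1; 0; 0; 1;   1; -1; 0; 0;  1; 1; 0; 0;   1; -1; 0; 0]
  | I2 => [:: 1; 0; 0; 1;   1; 1; 0; 0;   1; 1; 0; 0;   1; 1; 0; 0]
  | I3 => [:: 1; 1; 1; 1;   1; 0; -1; 0;  0; 0; 0; 0;   1; 0; 1; 0]
  | I4 => [:: 1; 1; 1; 1;   1; 0; 1; 0;   0; 0; 0; 0;   1; 0; -1; 0]
  | J0 => [:: 1; 0; 0; 1;   0; 0; 0; 0;   1; 1; 0; 0;   0; 0; 0; 0]
  | J2 => [:: 1; 0; 0; 1;   0; 0; 0; 0;   1; -1; 0; 0;  0; 0; 0; 0]
  | J1 => [:: 1; 0; 1; 0;   0; 0; 0; 0;   1; 0; 1; 0;   0; 0; 0; 0]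
  | J3 => [:: 1; 0; 1; 0;   0; 0; 0; 0;   1; 0; -1; 0;  0; 0; 0; 0]
  | J20 => [:: 1; 1; 1; 1;  0; 0; 0; 0;   0; 0; 0; 0;   0; 0; 0; 0]
  | J21 => [:: 1; 1; 0; 0;  1; 0; 1; 0;   0; 0; 0; 0;   0; 0; 0; 0]
  | J22 => [:: 1; 1; 0; 0;  1; 0; -1; 0;  0; 0; 0; 0;   0; 0; 0; 0]
  | J23 => [:: 1; 1; 0; 0;  0; 0; 0; 0;   0; 0; 0; 0;   1; 0; -1; 0]
  | J24 => [:: 1; 1; 0; 0;  0; 0; 0; 0;   0; 0; 0; 0;   1; 0; 1; 0]
  | K2 => [:: 1; 1; 0; 0;   0; 0; 0; 0;   0; 0; 0; 0;   0; 0; 0; 0]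
  | K3 => [:: 1; 0; 1; 0;   0; 0; 0; 0;   0; 0; 0; 0;   0; 0; 0; 0]
  | K4 => [:: 1; 0; 0; 1;   0; 0; 0; 0;   0; 0; 0; 0;   0; 0; 0; 0]
  end.

(** The coordinates of [1], the Jones projection of the scalars. *)
Definition scalars_coords : seq Z :=
  [:: 1; 1; 1; 1;   2; 0; 0; 0;   2; 0; 0; 0;   2; 0; 0; 0].

(** The coordinates of [e1], the Jones projection of the whole algebra. *)
Definition whole_coords : seq Z :=
  [:: 1; 0; 0; 0;   0; 0; 0; 0;   0; 0; 0; 0;   0; 0; 0; 0].

Local Close Scope Z_scope.

Section Classification.
Variables (C : numClosedFieldType) (x : nat -> C).
Local Notation qeval := (ceval (fun v : nat * nat => x v.1 * x v.2)).

Hypothesis idem : forall i, (i < 16)%N -> qeval (cop i) = 2 * x i.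
Hypothesis jones : forall i j, (i < 16)%N -> (j < 16)%N ->
  qeval (jones_comb i j) = 2 * (x i * x j).
Hypothesis unital : x 0 = 1.

Definition has_coords (z : seq Z) : Prop :=
  [seq x i | i <- iota 0 16] = [seq zeval C k | k <- z].

Lemma geval_small :
  (geval C (Zpos 1, Z0) = 1) * (geval C (Zneg 1, Z0) = -1) *
  (geval C (Zpos 2, Z0) = 2) * (geval C (Zneg 2, Z0) = -2) *
  (geval C (Z0, Zpos 1) = 'i) *
  (geval C (Z0, Zneg 1) = -'i).
Proof.
do !split; rewrite /geval /= ?(zevalN _ 1) ?(zevalN _ 2) /zeval.
all: by rewrite ?mulr0 ?addr0 ?add0r ?mulrN ?mulr1.
Qed.

Lemma zeval_small :
  (zeval C Z0 = 0) * (zeval C (Zpos 1) = 1) * (zeval C (Zneg 1) = -1) *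
  (zeval C (Zpos 2) = 2).
Proof. by do !split; rewrite ?(zevalN _ 1). Qed.

(** In these two forms, an equation follows from one that is proportional to it
    by a call to [ring]. *)
Lemma eq_of_diff (L M A B : C) : L = M -> A - B = L - M -> A = B.
Proof. by move=> ->; rewrite subrr => /eqP; rewrite subr_eq0 => /eqP. Qed.

Lemma eq_of_diff2 (L M A B : C) : L = M -> 2 * (A - B) = L - M -> A = B.
Proof.
move=> -> /eqP; rewrite subrr mulf_eq0 (negbTE (two_neq0 C)) subr_eq0 => /eqP //.
Qed.

(* The formal combination in the equation is computed and then written out. *)
Ltac expand E :=
  match type of E with ceval _ ?c = _ =>
    let d := eval vm_compute in c in change c with d in E
  end;
  rewrite !ceval_cons ceval_nil !geval_small /= in E.

Ltac from E := expand E;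
  first [ apply: (eq_of_diff E); ring | apply: (eq_of_diff2 E); ring
        | apply: (eq_of_diff2 (esym E)); ring ].

(* [from_idem i] proves an equation that is the coordinate [i] of [p * p = p] up to
   a factor 1, 2 or -2, and [from_jones i j] one that is the coordinate [j] of
   [L_i p * p = crd_i p *: p]. Coordinates are numbered as in [pauli]. *)
Ltac from_idem i :=
  have := idem (isT : (i < 16)%N); let E := fresh in move=> E; from E.
Ltac from_jones i j :=
  have := jones (isT : (i < 16)%N) (isT : (j < 16)%N);
  let E := fresh in move=> E; from E.

Local Notation s1 := (x 0). Local Notation s2 := (x 1).
Local Notation s3 := (x 2). Local Notation s4 := (x 3).
Local Notation t1 := (x 4). Local Notation u1 := (x 5).
Local Notation v1 := (x 6). Local Notation w1 := (x 7).
Local Notation t2 := (x 8). Local Notation u2 := (x 9).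
Local Notation v2 := (x 10). Local Notation w2 := (x 11).
Local Notation t3 := (x 12). Local Notation u3 := (x 13).
Local Notation v3 := (x 14). Local Notation w3 := (x 15).

Lemma bool_root (s : C) : s * s = s -> s = 0 \/ s = 1.
Proof.
move=> ss; have : s * (s - 1) = 0 by rewrite mulrBr ss mulr1 subrr.
by move/eqP; rewrite mulf_eq0 subr_eq0 => /orP[]/eqP; [left | right].
Qed.

Lemma sign_root (s : C) : s * s = 1 -> s = 1 \/ s = -1.
Proof. by move/eqP; rewrite -expr2 sqrf_eq1 => /orP[]/eqP; [left | right]. Qed.

Lemma eqN0 (s : C) : s = - s -> s = 0.
Proof. by move=> e; apply: (eq_of_diff2 e); ring. Qed.

(** A character [s] with [s(p) = 1] fixes [p]: applied to
    [L_i p * p = crd_i p *: p], it gives [x_(i s) s(p) = x_i s(p)], where [i s] is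
    the product in the dual. So the coordinates that [s] exchanges agree, and those
    that it negates vanish. *)
Lemma fixed_eq (c d s : C) : c * s = d * s -> s = 1 -> c = d.
Proof. by move=> + s1; rewrite s1 !mulr1. Qed.

Lemma fixed_neg (c s : C) : c * s = - c * s -> s = 1 -> c = 0.
Proof. by move=> e s1; apply: eqN0; apply: fixed_eq s1. Qed.

(** The equations of [E^2 = E] for [E = (t + u X + v Y + w Z) / 2]. An idempotent
    that is not scalar has trace [t = 1], which accounts for [t u = u]. *)
Definition block_idem (t u v w : C) : Prop :=
  [/\ t * t + u * u + v * v + w * w = 2 * t, t * u = u, t * v = v & t * w = w].

Lemma block1 : block_idem t1 u1 v1 w1.
Proof. split; [from_idem 4%N|from_idem 5%N|from_idem 6%N|from_idem 7%N]. Qed.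

Lemma block2 : block_idem t2 u2 v2 w2.
Proof. split; [from_idem 8%N|from_idem 9%N|from_idem 10%N|from_idem 11%N]. Qed.

Lemma block3 : block_idem t3 u3 v3 w3.
Proof. split; [from_idem 12%N|from_idem 13%N|from_idem 14%N|from_idem 15%N]. Qed.

Lemma block_scalar t u v w :
  block_idem t u v w -> t != 1 -> [/\ u = 0, v = 0 & w = 0].
Proof.
move=> [_ tu tv tw] t1; have z c : t * c = c -> c = 0.
  move=> tc; have : (t - 1) * c = 0 by rewrite mulrBl tc mul1r subrr.
  by move/eqP; rewrite mulf_eq0 subr_eq0 (negbTE t1) => /eqP.
by split; apply: z.
Qed.

Lemma neq01 : (0 : C) != 1. Proof. by rewrite eq_sym oner_eq0. Qed.
Lemma neq21 : (2 : C) != 1.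
Proof. by rewrite -subr_eq0 [(2 : C) - 1](_ : _ = 1) ?oner_eq0 //; ring. Qed.

Lemma block_zero t u v w : block_idem t u v w -> t = 0 -> [/\ u = 0, v = 0 & w = 0].
Proof. by move=> h t0; apply: (block_scalar h); rewrite t0 neq01. Qed.

(** The equation leaves [t = 1 / 2] besides [t = 0], and the trace of an idempotent
    is an integer. *)
Lemma block_half t u v w : block_idem t u v w -> t = 2 * (t * t) -> t = 0.
Proof.
move=> h th; have [t1|nt1] := eqVneq t 1.
  by case/eqP: neq21; move: th; rewrite t1 !mulr1.
have [u0 v0 w0] := block_scalar h nt1; have [tt _ _ _] := h.
rewrite u0 v0 w0 !mulr0 !addr0 in tt.
have n3 : (3 : C) != 0 by rewrite (pnatr_eq0 _ 3).
apply: (mulfI n3); rewrite mulr0; apply: (eq_of_diff (esym th)).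
rewrite tt; ring.
Qed.

Definition listed : Prop :=
  [\/ has_coords scalars_coords, has_coords whole_coords
    | exists l, has_coords (label_coords l)].

Ltac by_values :=
  rewrite /has_coords /= !zeval_small;
  repeat match goal with H : x ?k = _ |- context [x ?k] => rewrite H end;
  reflexivity.

Ltac done_at l := apply: Or33; exists l; by_values.

Lemma listed_all : s2 = 1 -> s3 = 1 -> s4 = 1 -> listed.
Proof.
move=> e2 e3 e4; have := unital => e1.
have u20 : u2 = 0 by apply: (@fixed_neg _ s2) => //; from_jones 9%N 1%N.
have v20 : v2 = 0 by apply: (@fixed_neg _ s2) => //; from_jones 10%N 1%N.
have w20 : w2 = 0 by apply: (@fixed_neg _ s3) => //; from_jones 11%N 2%N.
have u10 : u1 = 0 by apply: (@fixed_neg _ s2) => //; from_jones 5%N 1%N.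
have w10 : w1 = 0 by apply: (@fixed_neg _ s2) => //; from_jones 7%N 1%N.
have u30 : u3 = 0 by apply: (@fixed_neg _ s2) => //; from_jones 13%N 1%N.
have w30 : w3 = 0 by apply: (@fixed_neg _ s2) => //; from_jones 15%N 1%N.
have t31 : t3 = t1 by apply: (@fixed_eq _ _ s3) => //; from_jones 4%N 2%N.
have v31 : v3 = - v1 by apply: (@fixed_eq _ _ s3) => //; from_jones 6%N 2%N.
have tt : (s1 + s2 + t2) * t1 + w2 * v1 = 2 * (t1 * t1) by from_jones 4%N 4%N.
have [b1 _ tv1 _] := block1; have [b2 _ _ _] := block2.
rewrite u10 w10 mulr0 !addr0 in b1; rewrite u20 v20 w20 !mulr0 !addr0 in b2.
rewrite e1 e2 w20 mul0r addr0 in tt.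
have : t2 * (t2 - 2) = 0 by rewrite mulrBr b2; ring.
move/eqP; rewrite mulf_eq0 subr_eq0 => /orP[]/eqP t2E; rewrite t2E in tt.
  have : 2 * (t1 * t1) = 2 * t1 by rewrite -tt; ring.
  move/(mulfI (two_neq0 C))/bool_root => [t10|t11].
    have [_ v10 _] := block_zero block1 t10; rewrite v10 oppr0 in v31.
    by rewrite t10 in t31; done_at J20.
  have /sign_root[v1E|v1E] : v1 * v1 = 1.
    by apply: (eq_of_diff b1); rewrite t11; ring.
  - by rewrite v1E in v31; rewrite t11 in t31; done_at I4.
  - by rewrite v1E opprK in v31; rewrite t11 in t31; done_at I3.
have /(mulfI (two_neq0 C)) : 2 * (t1 * t1) = 2 * (2 * t1) by rewrite -tt; ring.
move=> tt2; have : t1 * (t1 - 2) = 0 by rewrite mulrBr tt2; ring.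
move/eqP; rewrite mulf_eq0 subr_eq0 => /orP[]/eqP t1E.
  have [_ v10 _] := block_zero block1 t1E; rewrite v10 oppr0 in v31.
  by rewrite t1E in t31; done_at I0.
have [_ v10 _] := block_scalar block1 (eq_ind_r (fun c => c != 1) neq21 t1E).
rewrite v10 oppr0 in v31; rewrite t1E in t31.
by apply: Or31; by_values.
Qed.

Lemma listed_s2 : s2 = 1 -> s3 = 0 -> s4 = 0 -> listed.
Proof.
move=> e2 e3 e4; have := unital => e1.
have u20 : u2 = 0 by apply: (@fixed_neg _ s2) => //; from_jones 9%N 1%N.
have v20 : v2 = 0 by apply: (@fixed_neg _ s2) => //; from_jones 10%N 1%N.
have u10 : u1 = 0 by apply: (@fixed_neg _ s2) => //; from_jones 5%N 1%N.
have w10 : w1 = 0 by apply: (@fixed_neg _ s2) => //; from_jones 7%N 1%N.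
have u30 : u3 = 0 by apply: (@fixed_neg _ s2) => //; from_jones 13%N 1%N.
have w30 : w3 = 0 by apply: (@fixed_neg _ s2) => //; from_jones 15%N 1%N.
have [b1 _ tv1 _] := block1; have [b2 _ _ tw2] := block2.
have [b3 _ tv3 _] := block3.
have orth : t2 * t2 - u2 * u2 + v2 * v2 - w2 * w2 = 2 * (s3 * t2).
  by from_jones 2%N 8%N.
have ww : w2 * (s3 + s4 - s1 - s2) = 2 * (w2 * t2) by from_jones 11%N 8%N.
have w20 : w2 = 0.
  apply: eqN0; apply: (mulfI (two_neq0 C)); rewrite e1 e2 e3 e4 in ww.
  by rewrite mulrN -[in LHS]tw2 [t2 * _]mulrC -ww; ring.
rewrite u20 v20 w20 e3 !(mulr0, mul0r, subr0, addr0) in orth b2.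
have t20 : t2 = 0.
  by rewrite orth in b2; apply: (mulfI (two_neq0 C)); rewrite -b2 mulr0.
have tt1 : (s1 + s2 + t2) * t1 + w2 * v1 = 2 * (t1 * t1) by from_jones 4%N 4%N.
have tt3 : (s1 + s2 + t2) * t3 - w2 * v3 = 2 * (t3 * t3).
  by from_jones 12%N 12%N.
have t13 : (s3 + s4 + t2) * t3 + w2 * v3 = 2 * (t1 * t3) by from_jones 4%N 12%N.
rewrite e1 e2 e3 e4 t20 w20 !(mul0r, addr0, subr0) in tt1 tt3 t13.
have /esym/(mulfI (two_neq0 C))/bool_root tb1 := tt1.
have /esym/(mulfI (two_neq0 C))/bool_root tb3 := tt3.
rewrite u10 w10 !mulr0 !addr0 in b1; rewrite u30 w30 !mulr0 !addr0 in b3.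
case: tb1 => t1E; last first.
  have t30 : t3 = 0.
    by rewrite t1E mul1r in t13; apply: (mulfI (two_neq0 C)); rewrite -t13 mulr0.
  have [_ v30 _] := block_zero block3 t30.
  have /sign_root[v1E|v1E] : v1 * v1 = 1.
    by apply: (eq_of_diff b1); rewrite t1E; ring.
  - by done_at J21.
  - by done_at J22.
have [_ v10 _] := block_zero block1 t1E.
case: tb3 => t3E.
  have [_ v30 _] := block_zero block3 t3E.
  by done_at K2.
have /sign_root[v3E|v3E] : v3 * v3 = 1.
  by apply: (eq_of_diff b3); rewrite t3E; ring.
- by done_at J24.
- by done_at J23.
Qed.

Lemma listed_s3 : s2 = 0 -> s3 = 1 -> s4 = 0 -> listed.
Proof.
move=> e2 e3 e4; have := unital => e1.
have u20 : u2 = 0 by apply: (@fixed_neg _ s3) => //; from_jones 9%N 2%N.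
have w20 : w2 = 0 by apply: (@fixed_neg _ s3) => //; from_jones 11%N 2%N.
have t31 : t3 = t1 by apply: (@fixed_eq _ _ s3) => //; from_jones 4%N 2%N.
have u31 : u3 = - u1 by apply: (@fixed_eq _ _ s3) => //; from_jones 5%N 2%N.
have v31 : v3 = - v1 by apply: (@fixed_eq _ _ s3) => //; from_jones 6%N 2%N.
have w31 : w3 = w1 by apply: (@fixed_eq _ _ s3) => //; from_jones 7%N 2%N.
have [b1 _ tv1 _] := block1; have [b2 _ tv2 _] := block2.
have orth2 : t2 * t2 - u2 * u2 - v2 * v2 + w2 * w2 = 2 * (s2 * t2).
  by from_jones 1%N 8%N.
have orth1 : t1 * t1 - u1 * u1 + v1 * v1 - w1 * w1 = 2 * (s2 * t1).
  by from_jones 1%N 4%N.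
have tt : (s1 + s2 + t2) * t1 + w2 * v1 = 2 * (t1 * t1) by from_jones 4%N 4%N.
rewrite e1 e2 w20 mul0r !addr0 in tt.
rewrite e2 mul0r mulr0 in orth1.
rewrite u20 w20 e2 !(mul0r, mulr0, addr0, subr0) in orth2 b2.
have tb2 : t2 * t2 = t2.
  by apply: (mulfI (two_neq0 C)); rewrite -b2 -[v2 * v2]addr0 -orth2; ring.
have vv2 : v2 * v2 = t2 by apply: (eq_of_diff (esym orth2)); rewrite tb2; ring.
have tv : t1 * t1 + v1 * v1 = t1.
  apply: (mulfI (two_neq0 C)); rewrite -b1 -[LHS]subr0 -orth1; ring.
case: (bool_root tb2) => t2E.
  have [_ v20 _] := block_zero block2 t2E.
  rewrite t2E addr0 mul1r in tt.
  have t1E := block_half block1 tt; have [u10 v10 w10] := block_zero block1 t1E.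
  rewrite t1E in t31; rewrite u10 oppr0 in u31; rewrite v10 oppr0 in v31.
  by rewrite w10 in w31; done_at K3.
rewrite t2E in tt vv2.
have /esym/(mulfI (two_neq0 C))/bool_root[t1E|t1E] : 2 * t1 = 2 * (t1 * t1).
  by rewrite -tt; ring.
  have [u10 v10 w10] := block_zero block1 t1E.
  rewrite t1E in t31; rewrite u10 oppr0 in u31; rewrite v10 oppr0 in v31.
  rewrite w10 in w31; case: (sign_root vv2) => v2E.
  - by done_at J1.
  - by done_at J3.
have mixed : u2 * (u1 + u3) - v2 * (w1 + w3) = 2 * (u1 * t2).
  by from_jones 5%N 8%N.
have diag : v2 * u1 + (u2 + s2 - s1) * w1 = 2 * (w1 * t1) by from_jones 7%N 4%N.
have u1E : u1 = - (v2 * w1).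
  apply: (mulfI (two_neq0 C)); move: mixed; rewrite t2E u20 w31 => m.
  by apply: (eq_of_diff (esym m)); ring.
have w10 : w1 = 0.
  have n4 : (4 : C) != 0 by rewrite (pnatr_eq0 _ 4).
  apply: (mulfI n4).
  rewrite u1E mulrN [v2 * (v2 * _)]mulrA vv2 u20 e1 e2 t1E in diag.
  by apply: (eq_of_diff (esym diag)); ring.
rewrite w10 mulr0 oppr0 in u1E.
have v10 : v1 * v1 = 0 by apply: (eq_of_diff tv); rewrite t1E; ring.
case/eqP: neq21; move: b1.
by rewrite u1E w10 v10 t1E !(mulr0, mulr1, addr0) => <-.
Qed.

Lemma listed_s4 : s2 = 0 -> s3 = 0 -> s4 = 1 -> listed.
Proof.
move=> e2 e3 e4; have := unital => e1.
have v20 : v2 = 0 by apply: (@fixed_neg _ s4) => //; from_jones 10%N 3%N.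
have w20 : w2 = 0 by apply: (@fixed_neg _ s4) => //; from_jones 11%N 3%N.
have t31 : t3 = t1 by apply: (@fixed_eq _ _ s4) => //; from_jones 4%N 3%N.
have u31 : u3 = u1 by apply: (@fixed_eq _ _ s4) => //; from_jones 5%N 3%N.
have v31 : v3 = - v1 by apply: (@fixed_eq _ _ s4) => //; from_jones 6%N 3%N.
have w31 : w3 = - w1 by apply: (@fixed_eq _ _ s4) => //; from_jones 7%N 3%N.
have [b1 _ tv1 _] := block1; have [b2 _ tv2 _] := block2.
have orth2 : t2 * t2 - u2 * u2 - v2 * v2 + w2 * w2 = 2 * (s2 * t2).
  by from_jones 1%N 8%N.
have orth1 : t1 * t1 - u1 * u1 + v1 * v1 - w1 * w1 = 2 * (s2 * t1).
  by from_jones 1%N 4%N.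
have tt : (s1 + s2 + t2) * t1 + w2 * v1 = 2 * (t1 * t1) by from_jones 4%N 4%N.
rewrite e1 e2 w20 mul0r !addr0 in tt.
rewrite e2 mul0r mulr0 in orth1.
rewrite v20 w20 e2 !(mul0r, mulr0, addr0, subr0) in orth2 b2.
have tb2 : t2 * t2 = t2.
  by apply: (mulfI (two_neq0 C)); rewrite -b2 -[u2 * u2]addr0 -orth2; ring.
have uu2 : u2 * u2 = t2 by apply: (eq_of_diff (esym orth2)); rewrite tb2; ring.
have tv : t1 * t1 + v1 * v1 = t1.
  apply: (mulfI (two_neq0 C)); rewrite -b1 -[LHS]subr0 -orth1; ring.
case: (bool_root tb2) => t2E.
  have [u20 _ _] := block_zero block2 t2E.
  rewrite t2E addr0 mul1r in tt.
  have t1E := block_half block1 tt; have [u10 v10 w10] := block_zero block1 t1E.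
  rewrite t1E in t31; rewrite u10 in u31; rewrite v10 oppr0 in v31.
  by rewrite w10 oppr0 in w31; done_at K4.
rewrite t2E in tt uu2.
have /esym/(mulfI (two_neq0 C))/bool_root[t1E|t1E] : 2 * t1 = 2 * (t1 * t1).
  by rewrite -tt; ring.
  have [u10 v10 w10] := block_zero block1 t1E.
  rewrite t1E in t31; rewrite u10 in u31; rewrite v10 oppr0 in v31.
  rewrite w10 oppr0 in w31; case: (sign_root uu2) => u2E.
  - by done_at J0.
  - by done_at J2.
have mixed : u2 * (u1 + u3) - v2 * (w1 + w3) = 2 * (u1 * t2).
  by from_jones 5%N 8%N.
have diag : v2 * u1 + (u2 + s2 - s1) * w1 = 2 * (w1 * t1) by from_jones 7%N 4%N.
have v10 : v1 = 0.
  have /eqP : v1 * v1 = 0 by apply: (eq_of_diff tv); rewrite t1E; ring.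
  by rewrite mulf_eq0 orbb => /eqP.
have w10 : w1 = 0.
  rewrite v20 e1 e2 t1E in diag; case: (sign_root uu2) => u2E; rewrite u2E in diag.
    by apply: (eq_of_diff2 (esym diag)); ring.
  have n4 : (4 : C) != 0 by rewrite (pnatr_eq0 _ 4).
  by apply: (mulfI n4); apply: (eq_of_diff (esym diag)); ring.
have /sign_root u1E : u1 * u1 = 1.
  by apply: (eq_of_diff b1); rewrite t1E v10 w10; ring.
have u2E : u2 = 1.
  have u1n : u1 != 0 by case: u1E => ->; rewrite ?oppr_eq0 oner_eq0.
  apply: (mulfI (two_neq0 C)); apply: (mulfI u1n); rewrite u31 v20 t2E in mixed.
  by apply: (eq_of_diff mixed); ring.
rewrite t1E in t31; rewrite v10 oppr0 in v31; rewrite w10 oppr0 in w31.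
case: u1E => u1E; rewrite u1E in u31.
- by done_at I2.
- by done_at I1.
Qed.

Lemma listed_none : s2 = 0 -> s3 = 0 -> s4 = 0 -> listed.
Proof.
move=> e2 e3 e4; have := unital => e1.
have tt2 : (s1 + s2 + s3 + s4) * t2 = 2 * (t2 * t2) by from_jones 8%N 8%N.
rewrite e1 e2 e3 e4 !addr0 mul1r in tt2.
have t20 := block_half block2 tt2; have [u20 v20 w20] := block_zero block2 t20.
have tt1 : (s1 + s2 + t2) * t1 + w2 * v1 = 2 * (t1 * t1) by from_jones 4%N 4%N.
have tt3 : (s1 + s2 + t2) * t3 - w2 * v3 = 2 * (t3 * t3).
  by from_jones 12%N 12%N.
rewrite e1 e2 t20 w20 !(mul0r, addr0, subr0, mul1r) in tt1 tt3.
have t10 := block_half block1 tt1; have [u10 v10 w10] := block_zero block1 t10.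
have t30 := block_half block3 tt3; have [u30 v30 w30] := block_zero block3 t30.
by apply: Or32; by_values.
Qed.

(** The three products [s3 s4 = s2 s4], [s4 s3 = s2 s3] and [s4 s2 = s3 s2] say that
    the characters of value 1 on [p] form a group, which leaves five cases. *)
Lemma jones_listed : listed.
Proof.
have /bool_root b2 : s2 * s2 = s2 by from_idem 1%N.
have /bool_root b3 : s3 * s3 = s3 by from_idem 2%N.
have /bool_root b4 : s4 * s4 = s4 by from_idem 3%N.
have e24 : s3 * s4 = s2 * s4 by from_jones 1%N 3%N.
have e23 : s4 * s3 = s2 * s3 by from_jones 1%N 2%N.
have e32 : s4 * s2 = s3 * s2 by from_jones 2%N 1%N.
case: b2 => e2; case: b3 => e3; case: b4 => e4.
all: rewrite e2 e3 e4 !(mulr0, mul0r, mul1r) in e24 e23 e32.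
- exact: listed_none.
- exact: listed_s4.
- exact: listed_s3.
- by case/eqP: neq01; rewrite e24.
- exact: listed_s2.
- by case/eqP: neq01; rewrite e24.
- by case/eqP: neq01; rewrite e23.
- exact: listed_all.
Qed.

End Classification.

(** * The lattice over an abstract field of complex numbers *)
Definition all_labels : seq KD4_label :=
  [:: I0; I1; I2; I3; I4; J0; J2; J1; J3; J20; J21; J22; J23; J24; K2; K3; K4].

Lemma all_labelsP (P : KD4_label -> bool) : all P all_labels -> forall l, P l.
Proof. by move=> /= h; case; repeat (case/andP: h => ? h). Qed.

(** The value of a linear form at an integral point, and below of a quadratic
    form. *)
Definition zvalue (z : seq Z) (c : comb nat) : gint :=
  foldr (fun t s => gadd (gmult t.1 (gz (nth Z0 z t.2))) s) (gz 0) c.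

Definition zvalue2 (z : seq Z) (c : comb (nat * nat)) : gint :=
  foldr (fun t s =>
    gadd (gmult t.1 (gz (Z.mul (nth Z0 z t.2.1) (nth Z0 z t.2.2)))) s) (gz 0) c.

Definition geq (u v : gint) : bool := gzero (gadd u (gmult (gz (-1)) v)).

Definition is_solution (z : seq Z) : bool :=
  [&& size z == 16, Z.eqb (nth Z0 z 0) 1,
      all (fun i => geq (zvalue2 z (cop i)) (gmult (gz 2) (gz (nth Z0 z i))))
        (iota 0 16) &
      all (fun i => all (fun j =>
        geq (zvalue2 z (jones_comb i j))
            (gmult (gz 2) (gmult (gz (nth Z0 z i)) (gz (nth Z0 z j)))))
        (iota 0 16)) (iota 0 16)]%N.

Lemma label_coords_solution :
  all (fun l => is_solution (label_coords l)) all_labels.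
Proof. by vm_compute. Qed.

Lemma scalars_coords_solution : is_solution scalars_coords.
Proof. by vm_compute. Qed.

Lemma whole_coords_solution : is_solution whole_coords.
Proof. by vm_compute. Qed.

(** The equation [d * weight p = 16]. *)
Definition has_dim (z : seq Z) (d : nat) : bool :=
  geq (gmult (gz (Z.of_nat d)) (zvalue z mass)) (gz 16).

Lemma label_dim : all (fun l => has_dim (label_coords l) (KD4_dim l)) all_labels.
Proof. by vm_compute. Qed.

Definition minus (c : comb mono) : comb mono := cscale (gz (-1)) c.
(** The four combinations below are those of the projections [p11], [p22], [r11],
    [r22] in the waves defined further on. The sign of [r11] and [r22] looks
    reversed because the pairing of waves with modes is bilinear: [v] is
    a combination with the imaginary coefficients ['i] and [- 'i], and its pairing
    with itself is -2. *)
Definition p11_comb j : comb mono := pauli (4 * j) ++ pauli (4 * j + 1).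
Definition p22_comb j : comb mono := pauli (4 * j) ++ minus (pauli (4 * j + 1)).
Definition r11_comb j : comb mono := pauli (4 * j) ++ minus (pauli (4 * j + 2)).
Definition r22_comb j : comb mono := pauli (4 * j) ++ pauli (4 * j + 2).

Definition proj_comb (l : KD4_label) : comb mono :=
  let e1 := pauli 0 in let e2 := pauli 1 in
  let e3 := pauli 2 in let e4 := pauli 3 in
  let r11 := r11_comb in let r22 := r22_comb in
  let p1 := p11_comb 1 ++ p11_comb 3 in let p2 := p22_comb 1 ++ p22_comb 3 in
  let q1 := p11_comb 2 in let q2 := p22_comb 2 in
  match l with
  | I0 => ((((e1 ++ e2) ++ e3) ++ e4) ++ q1) ++ q2
  | I1 => ((e1 ++ e4) ++ q1) ++ p2
  | I2 => ((e1 ++ e4) ++ q1) ++ p1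
  | I3 => ((((e1 ++ e2) ++ e3) ++ e4) ++ r22 1) ++ r11 3
  | I4 => ((((e1 ++ e2) ++ e3) ++ e4) ++ r11 1) ++ r22 3
  | J0 => (e1 ++ e4) ++ q1
  | J2 => (e1 ++ e4) ++ q2
  | J1 => (e1 ++ e3) ++ r11 2
  | J3 => (e1 ++ e3) ++ r22 2
  | J20 => ((e1 ++ e2) ++ e3) ++ e4
  | J21 => (e1 ++ e2) ++ r11 1
  | J22 => (e1 ++ e2) ++ r22 1
  | J23 => (e1 ++ e2) ++ r22 3
  | J24 => (e1 ++ e2) ++ r11 3
  | K2 => e1 ++ e2
  | K3 => e1 ++ e3
  | K4 => e1 ++ e4
  end%N.

(** Waves and modes are dual bases. *)
Definition wave_match (v u : mono) : bool :=
  (v.2 == u.2) && ((v.1 + 7 * u.1) %% 8 == 0)%N.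

Definition pairing (i : nat) (c : comb mono) : comb unit :=
  csubst (fun u => [seq (t.1, tt) | t <- pauli i & wave_match t.2 u]) c.

Lemma pairing_label :
  all (fun l => all (fun i =>
    ceq (pairing i (proj_comb l))
        [:: (gz (Z.mul 2 (nth Z0 (label_coords l) i)), tt)])
    (iota 0 16)) all_labels.
Proof. by vm_compute. Qed.

Lemma pairing_e1 :
  all (fun i =>
    ceq (pairing i (pauli 0)) [:: (gz (Z.mul 2 (nth Z0 whole_coords i)), tt)])
    (iota 0 16).
Proof. by vm_compute. Qed.

Lemma label_coords_inj : injective label_coords.
Proof. by case; case. Qed.

Section Main.
Variables (C : numClosedFieldType) (eps : C) (gT : finGroupType) (a b : gT).
Hypothesis eps4 : eps ^+ 4 = -1.
Hypothesis hab : dihedral_generators 4 a b.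
Local Notation K := (group_algebra C gT).
Local Notation crd := (@crd C eps gT a b).
Local Notation L := (@lslice C eps gT a b).
Local Notation Delta := (@twisted_coproduct C gT a b).
Local Notation coideal_of := (@coideal_of C eps gT a b).
Local Notation coideal_projection := (@coideal_projection C eps gT a b).
Local Notation word := (word a b).
Implicit Types (p q : K).

Lemma zeval_inj : injective (zeval C).
Proof. by move=> x y /intr_inj/(can_inj int_of_ZK). Qed.

Lemma geqP u v : geq u v -> geval C u = geval C v.
Proof.
move=> /(geval0 C); rewrite gevalD gevalM (geval_small C).1.1.1.1.2 mulN1r.
by move/eqP; rewrite subr_eq0 => /eqP.
Qed.

Lemma geval_gz k : geval C (gz k) = zeval C k.
Proof. by rewrite /geval /zeval mulr0 addr0. Qed.

Section Coordinates.
Variables (p : K) (z : seq Z).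
Hypothesis zsol : is_solution z.
Hypothesis pz : has_coords (crd^~ p) z.

Lemma coords_nth i : (i < 16)%N -> crd i p = zeval C (nth Z0 z i).
Proof.
move=> i16; have /and4P[/eqP sz _ _ _] := zsol.
have := congr1 (fun s => nth 0 s i) pz; rewrite (nth_map 0%N) ?size_iota //.
by rewrite nth_iota // (nth_map Z0) ?sz.
Qed.

Lemma zvalueE c : all (fun t => (t.2 < 16)%N) c ->
  ceval (crd^~ p) c = geval C (zvalue z c).
Proof.
elim: c => [|t c IH] /=; first by rewrite ceval_nil geval_gz.
by case/andP=> t16 c16; rewrite ceval_cons gevalD gevalM geval_gz IH // coords_nth.
Qed.

Lemma zvalue2E c : all (fun t => (t.2.1 < 16) && (t.2.2 < 16))%N c ->
  ceval (fun v => crd v.1 p * crd v.2 p) c = geval C (zvalue2 z c).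
Proof.
elim: c => [|t c IH] /=; first by rewrite ceval_nil geval_gz.
case/andP=> /andP[t1 t2] c16.
by rewrite ceval_cons gevalD gevalM geval_gz IH // !coords_nth // zevalM.
Qed.
End Coordinates.

Lemma jones_comb_lt16 i j : (i < 16)%N -> (j < 16)%N ->
  all (fun t => (t.2.1 < 16) && (t.2.2 < 16))%N (jones_comb i j).
Proof.
have tab : all (fun i => all (fun j =>
    all (fun t => (t.2.1 < 16) && (t.2.2 < 16))%N (jones_comb i j))
    (iota 0 16)) (iota 0 16).
  by vm_compute.
by move=> i16; apply: (all_iotaP (all_iotaP tab i16)).
Qed.

Lemma crd_jones i j p : (i < 16)%N -> (j < 16)%N ->
  2 * crd j (L i p * p) = ceval (fun v => crd v.1 p * crd v.2 p) (jones_comb i j).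
Proof.
move=> i16 j16; rewrite (crd_mul eps4 hab) // ceval_subst.
apply: (eq_ceval_pair16 (cop_lt16 j16)) => c d c16 d16.
rewrite (crd_lslice eps4 hab) // ceval_prod ceval_mulr; apply: eq_ceval => m.
by rewrite ceval1 geval1 mul1r.
Qed.

Lemma solution_weight p z d : is_solution z -> has_dim z d ->
  has_coords (crd^~ p) z -> d%:R * weight eps a b p = 16.
Proof.
move=> zsol zd pz; have := geqP zd; rewrite gevalM -(zvalueE zsol pz) // !geval_gz.
rewrite /zeval (_ : int_of_Z (Z.of_nat d) = d) //.
by case: (d) => //= k; rewrite SuccNat2Pos.id_succ.
Qed.

(** An integral solution of the quadratic equations is a projection that absorbs
    itself; it is self-adjoint because its coordinates are real. *)
Lemma solution_projection p z d : is_solution z -> has_dim z d ->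
  has_coords (crd^~ p) z -> coideal_projection p.
Proof.
move=> zsol zd pz; have cz := coords_nth zsol pz.
have /and4P[_ z0 idem jones] := zsol; split.
- split; apply: (crd_inj eps4 hab) => i i16.
    by rewrite (crd_star eps4 hab) // cz // rmorph_int.
  apply: (mulfI (two_neq0 C)); rewrite (crd_mul eps4 hab) //.
  rewrite (zvalue2E zsol pz); last exact: cop_lt16.
  by rewrite (geqP (all_iotaP idem i16)) gevalM !geval_gz cz.
- by rewrite -(crd0 eps4 hab) cz //; move/Z.eqb_eq: z0 => ->.
- move=> i i16; apply: (crd_inj eps4 hab) => j j16; rewrite crdZ.
  apply: (mulfI (two_neq0 C)); rewrite crd_jones //.
  rewrite (zvalue2E zsol pz); last exact: jones_comb_lt16.
  by rewrite (geqP (all_iotaP (all_iotaP jones i16) j16)) !gevalM !geval_gz !cz.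
- apply/eqP => w0; have := solution_weight zsol zd pz; rewrite w0 mulr0.
  by move/esym/eqP; rewrite (pnatr_eq0 _ 16).
Qed.

Lemma solution_dim p z d : is_solution z -> has_dim z d ->
  has_coords (crd^~ p) z -> \dim (coideal_of p) = d.
Proof.
move=> zsol zd pz; have pJ := solution_projection zsol zd pz.
have w0 : weight eps a b p != 0 by case: pJ.
apply/eqP; rewrite -(eqr_nat C) (dim_coideal_of eps4 hab pJ).
by rewrite -(solution_weight zsol zd pz) mulfK.
Qed.

Lemma has_coords_inj p q z :
  has_coords (crd^~ p) z -> has_coords (crd^~ q) z -> p = q.
Proof.
move=> pz qz; apply: (crd_inj eps4 hab) => i i16.
have := congr1 (fun s => nth 0 s i) (etrans pz (esym qz)).
by rewrite !(nth_map 0%N) ?size_iota // nth_iota.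
Qed.

Lemma coords_inj p z z' :
  has_coords (crd^~ p) z -> has_coords (crd^~ p) z' -> z = z'.
Proof. by move=> pz pz'; apply: (inj_map zeval_inj); rewrite -pz -pz'. Qed.

(** ** The projections with these coordinates *)

(** The basis of [K] dual to the modes. *)
Definition wave (u : mono) : K :=
  8^-1 *: \sum_(k < 8) eps ^+ (7 * u.1 * k) *: lambda C (word u.2 k).

Lemma ev_wave v u : ev (@mode C eps gT a b v) (wave u) = (wave_match v u)%:R.
Proof.
rewrite /wave evZ ev_sum.
transitivity (8^-1 * ((u.2 == v.2)%:R * \sum_(k < 8) eps ^+ ((v.1 + 7 * u.1) * k))).
  congr (_ * _); rewrite mulr_sumr; apply: eq_bigr => k _.
  by rewrite evZ ev_lambda (mode_word eps4 hab) mulrCA -exprD addnC -mulnDl.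
rewrite (eighth_root_sum eps4) /wave_match eq_sym; case: (v.2 == u.2).
  by case: ifP => _; rewrite ?mulr0 // mul1r mulVf // (pnatr_eq0 C 8).
by rewrite mul0r mulr0.
Qed.

Definition wave_comb (c : comb mono) : K :=
  2^-1 *: \sum_(t <- c) geval C t.1 *: wave t.2.

Lemma crd_wave_comb i c : 2 * crd i (wave_comb c) = ceval (fun=> 1) (pairing i c).
Proof.
rewrite /wave_comb crdZ mulrA divff ?(two_neq0 C) // mul1r /crd ev_sum ceval_subst.
apply: eq_bigr => t _; rewrite evZ; congr (_ * _).
rewrite /pauli_fun ev_ceval /ceval big_map big_filter [RHS]big_mkcond.
apply: eq_bigr => s _; rewrite ev_wave; case: wave_match; rewrite ?mulr1 ?mulr0 //.
Qed.

Lemma wave_comb_coords c z : size z = 16%N ->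
  (forall i, (i < 16)%N ->
     ceq (pairing i c) [:: (gz (Z.mul 2 (nth Z0 z i)), tt)]) ->
  has_coords (crd^~ (wave_comb c)) z.
Proof.
move=> sz cz; apply: (@eq_from_nth _ 0) => [|i].
  by rewrite !size_map size_iota.
rewrite size_map size_iota => i16.
rewrite (nth_map 0%N) ?size_iota // nth_iota // (nth_map Z0) ?sz //.
apply: (mulfI (two_neq0 C)); rewrite crd_wave_comb (ceqP _ (cz i i16)) ceval1 mulr1.
by rewrite geval_gz zevalM.
Qed.

Lemma wave_comb_cat c d : wave_comb (c ++ d) = wave_comb c + wave_comb d.
Proof. by rewrite /wave_comb big_cat scalerDr. Qed.

Lemma wave_la (c : nat -> C) j : (forall k, c k = eps ^+ (7 * j * k)) ->
  (2 * 4)%:R^-1 *: \sum_(k < 2 * 4) c k *: lambda C (a ^+ k)%g = wave (j, false).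
Proof.
move=> cE; congr (_ *: _); apply: eq_bigr => k _.
by rewrite cE /word mul1g.
Qed.

Lemma wave_lba (c : nat -> C) j : (forall k, c k = eps ^+ (7 * j * k)) ->
  (2 * 4)%:R^-1 *: \sum_(k < 2 * 4) c k *: lambda C (b * a ^+ k)%g = wave (j, true).
Proof. by move=> cE; congr (_ *: _); apply: eq_bigr => k _; rewrite cE. Qed.

Lemma wave_pair (c : nat -> C) j s : (forall k, c k = eps ^+ (7 * j * k)) ->
  (4 * 4)%:R^-1 *:
    \sum_(k < 2 * 4)
      c k *: (lambda C (a ^+ k)%g + geval C s *: lambda C (b * a ^+ k)%g) =
  wave_comb [:: (gz 1, (j, false)); (s, (j, true))].
Proof.
move=> cE; rewrite /wave_comb !big_cons big_nil addr0 geval1 scale1r.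
rewrite -(wave_la cE) -(wave_lba cE) scalerA [geval C s * _]mulrC -scalerA.
rewrite -scalerDr scalerA -invfM -natrM.
congr (_ *: _); rewrite scaler_sumr -big_split; apply: eq_bigr => k _ /=.
by rewrite scalerDr !scalerA [c k * _]mulrC.
Qed.

Lemma sign_eighth_root k : (-1) ^+ k = eps ^+ (7 * 4 * k).
Proof.
rewrite [(7 * 4)%N]mulnC -mulnA exprM eps4 -[RHS]signr_odd oddM.
by rewrite signr_odd.
Qed.

Local Notation la k := (lambda C (a ^+ k)%g).
Local Notation lba k := (lambda C (b * a ^+ k)%g).

Lemma wave_e1 :
  (4 * 4)%:R^-1 *: \sum_(k < 2 * 4) (la k + lba k) = wave_comb (pauli 0).
Proof.
have <- := @wave_pair (fun=> 1) 0 (gz 1) (fun k => esym (expr0 eps)).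
by congr (_ *: _); apply: eq_bigr => k _; rewrite geval1 !scale1r.
Qed.

Lemma wave_e2 :
  (4 * 4)%:R^-1 *: \sum_(k < 2 * 4) (la k - lba k) = wave_comb (pauli 1).
Proof.
have <- := @wave_pair (fun=> 1) 0 (gz (-1)) (fun k => esym (expr0 eps)).
by congr (_ *: _); apply: eq_bigr => k _; rewrite gevalN1 scale1r scaleN1r.
Qed.

Lemma wave_e3 :
  (4 * 4)%:R^-1 *: \sum_(k < 2 * 4) (-1) ^+ k *: (la k - lba k) =
  wave_comb (pauli 2).
Proof.
have <- := @wave_pair (fun k => (-1) ^+ k) 4 (gz (-1)) sign_eighth_root.
by congr (_ *: _); apply: eq_bigr => k _; rewrite gevalN1 scaleN1r.
Qed.

Lemma wave_e4 :
  (4 * 4)%:R^-1 *: \sum_(k < 2 * 4) (-1) ^+ k *: (la k + lba k) =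
  wave_comb (pauli 3).
Proof.
have <- := @wave_pair (fun k => (-1) ^+ k) 4 (gz 1) sign_eighth_root.
by congr (_ *: _); apply: eq_bigr => k _; rewrite geval1 scale1r.
Qed.

Lemma pauli_block j : (0 < j < 4)%N ->
  [/\ pauli (4 * j) = [:: (gz 1, (j, false)); (gz 1, ((8 - j)%N, false))],
      pauli (4 * j + 1) = [:: (gz 1, (j, true)); (gz 1, ((8 - j)%N, true))]
    & pauli (4 * j + 2) = [:: (gi, ((8 - j)%N, true)); (gconj gi, (j, true))]].
Proof. by case: j => [|[|[|[|]]]]. Qed.

Lemma wave_block j s s' : (0 < j < 4)%N ->
  2^-1 *: (wave (j, false) + geval C s *: wave ((8 - j)%N, true)
           + geval C s' *: wave (j, true) + wave ((8 - j)%N, false)) =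
  wave_comb (pauli (4 * j) ++ [:: (s, ((8 - j)%N, true)); (s', (j, true))]).
Proof.
move=> /pauli_block[-> _ _]; rewrite /wave_comb !big_cons big_nil addr0 !geval1.
by rewrite !scale1r -!addrA; congr (_ *: (_ + _)); rewrite [RHS]addrC addrA.
Qed.

Lemma wave_comb_perm c d : perm_eq c d -> wave_comb c = wave_comb d.
Proof. by move=> cd; rewrite /wave_comb (perm_big _ cd). Qed.

Lemma wave_p11 j : (0 < j < 4)%N ->
  2^-1 *: (wave (j, false) + wave ((8 - j)%N, true) + wave (j, true)
           + wave ((8 - j)%N, false)) = wave_comb (p11_comb j).
Proof.
move=> j4; have [_ p _] := pauli_block j4; rewrite /p11_comb p.
have := wave_block (gz 1) (gz 1) j4; rewrite !geval1 !scale1r => ->.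
apply: wave_comb_perm; rewrite perm_cat2l.
by apply/seq.permP => f /=; rewrite !addn0 addnC.
Qed.

Lemma wave_p22 j : (0 < j < 4)%N ->
  2^-1 *: (wave (j, false) - wave ((8 - j)%N, true) - wave (j, true)
           + wave ((8 - j)%N, false)) = wave_comb (p22_comb j).
Proof.
move=> j4; have [_ p _] := pauli_block j4; rewrite /p22_comb p.
have := wave_block (gz (-1)) (gz (-1)) j4; rewrite !gevalN1 !scaleN1r => ->.
apply: wave_comb_perm; rewrite perm_cat2l.
by apply/seq.permP => f /=; rewrite !addn0 addnC.
Qed.

Lemma wave_r11 j : (0 < j < 4)%N ->
  2^-1 *: (wave (j, false) - 'i *: wave ((8 - j)%N, true) + 'i *: wave (j, true)
           + wave ((8 - j)%N, false)) = wave_comb (r11_comb j).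
Proof.
move=> j4; have [_ _ p] := pauli_block j4; rewrite /r11_comb p.
have := wave_block (gconj gi) gi j4; rewrite geval_gi geval_giN scaleNr => -> //.
Qed.

Lemma wave_r22 j : (0 < j < 4)%N ->
  2^-1 *: (wave (j, false) + 'i *: wave ((8 - j)%N, true) - 'i *: wave (j, true)
           + wave ((8 - j)%N, false)) = wave_comb (r22_comb j).
Proof.
move=> j4; have [_ _ p] := pauli_block j4; rewrite /r22_comb p.
have := wave_block gi (gconj gi) j4; rewrite geval_gi geval_giN scaleNr => -> //.
Qed.

Definition label_proj (l : KD4_label) : K := wave_comb (proj_comb l).

Lemma label_sol l : is_solution (label_coords l).
Proof. exact: (all_labelsP label_coords_solution). Qed.

Lemma label_has_dim l : has_dim (label_coords l) (KD4_dim l).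
Proof. exact: (all_labelsP label_dim). Qed.

Lemma label_proj_coords l : has_coords (crd^~ (label_proj l)) (label_coords l).
Proof.
apply: wave_comb_coords; first by case/and4P: (label_sol l) => /eqP.
exact: (all_iotaP (all_labelsP pairing_label l)).
Qed.

Lemma whole_proj_coords : has_coords (crd^~ (wave_comb (pauli 0))) whole_coords.
Proof. by apply: wave_comb_coords => //; exact: (all_iotaP pairing_e1). Qed.

Lemma one_coords : has_coords (crd^~ 1) scalars_coords.
Proof.
apply: (@eq_from_nth _ 0) => [|i]; first by rewrite !size_map size_iota.
rewrite size_map size_iota => i16.
rewrite (nth_map 0%N) ?size_iota // nth_iota // (nth_map Z0) //.
rewrite (crd_one eps4 hab) //.
by rewrite geval_gz; congr zeval; do 16?[case: i i16 => [|i] i16 //].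
Qed.

Lemma coideal_of_one : coideal_of 1 = <[1 : K]>%VS.
Proof.
have sol := scalars_coords_solution; have dim1 : has_dim scalars_coords 1 by [].
have pJ := solution_projection sol dim1 one_coords.
apply/esym/eqP; rewrite eqEdim (solution_dim sol dim1 one_coords).
rewrite dim_vline oner_eq0 andbT.
by rewrite -memvE; apply/(coideal_ofP eps4 hab _ pJ); apply: absorbs1.
Qed.

Lemma dim_group_algebra : \dim {: K} = 16%N.
Proof. by case: hab => _ _ _ _; rewrite dimvf /dim /= muln1 => ->. Qed.

Lemma coideal_of_whole : coideal_of (wave_comb (pauli 0)) = fullv.
Proof.
have sol := whole_coords_solution; have dim16 : has_dim whole_coords 16 by [].
apply/eqP; rewrite eqEdim subvf (solution_dim sol dim16 whole_proj_coords).
by rewrite dim_group_algebra.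
Qed.

(** The Jones projection of a coideal subalgebra satisfies the quadratic
    equations. *)
Lemma coideal_jones_coords (I : {vspace K}) p : coideal_subalgebra Delta I ->
  jones_projection I p ->
  exists2 z, has_coords (crd^~ p) z &
    [\/ z = scalars_coords, z = whole_coords | exists l, z = label_coords l].
Proof.
move=> Ico [[pI pproj p0 pE] _]; have e1 := projection_eps pI pproj p0 pE.
have pp := coideal_absorbs eps4 hab Ico pE pI.
have [z1|z2|[l zl]] : listed (crd^~ p).
- apply: jones_listed; last by rewrite (crd0 eps4 hab).
  + by move=> i i16; rewrite -(crd_mul eps4 hab) // (pproj.2).
  + by move=> i j i16 j16; rewrite -crd_jones // pp // crdZ.
- by exists scalars_coords => //; apply: Or31.
- by exists whole_coords => //; apply: Or32.
- by exists (label_coords l) => //; apply: Or33; exists l.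
Qed.

Definition subalgebra_of_label (l : KD4_label) : {vspace K} :=
  coideal_of (label_proj l).

Lemma label_projP l : coideal_projection (label_proj l).
Proof.
exact: solution_projection (label_sol l) (label_has_dim l) (label_proj_coords l).
Qed.

Lemma coideal_classification (I : {vspace K}) :
  coideal_subalgebra Delta I <->
  [\/ I = <[1 : K]>%VS, I = fullv | exists l, I = subalgebra_of_label l].
Proof.
have solS := scalars_coords_solution; have dimS : has_dim scalars_coords 1 by [].
have solW := whole_coords_solution; have dimW : has_dim whole_coords 16 by [].
split=> [Ico | [->|->|[l ->]]]; first last.
- exact: (coideal_of_coideal eps4 hab (label_projP l)).
- rewrite -coideal_of_whole; apply: (coideal_of_coideal eps4 hab).
  exact: solution_projection solW dimW whole_proj_coords.
- rewrite -coideal_of_one; apply: (coideal_of_coideal eps4 hab).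
  exact: solution_projection solS dimS one_coords.
have [p pJ] : exists p, jones_projection I p.
  by case: Ico => I1 IM Is _; apply: jones_projection_exists.
have [z pz zE] := coideal_jones_coords Ico pJ; have [[pI _ _ pE] _] := pJ.
case: zE pz => [->|->|[l ->]] pz.
- apply: Or31; rewrite -coideal_of_one -(has_coords_inj pz one_coords).
  exact: (coideal_eq eps4 hab Ico pI pE (solution_projection solS dimS pz)).
- apply: Or32; rewrite -coideal_of_whole -(has_coords_inj pz whole_proj_coords).
  exact: (coideal_eq eps4 hab Ico pI pE (solution_projection solW dimW pz)).
- apply: Or33; exists l.
  rewrite /subalgebra_of_label -(has_coords_inj pz (label_proj_coords l)).
  apply: (coideal_eq eps4 hab Ico pI pE).
  exact: solution_projection (label_sol l) (label_has_dim l) pz.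
Qed.

Lemma coideal_of_projection (I : {vspace K}) : coideal_subalgebra Delta I ->
  exists2 p, coideal_projection p & I = coideal_of p.
Proof.
move=> /coideal_classification [->|->|[l ->]].
- exists 1; last by rewrite coideal_of_one.
  by apply: (solution_projection (d := 1) scalars_coords_solution _ one_coords).
- exists (wave_comb (pauli 0)); last by rewrite coideal_of_whole.
  apply: (solution_projection (d := 16) whole_coords_solution _ _) => //.
  exact: whole_proj_coords.
- by exists (label_proj l) => //; apply: label_projP.
Qed.

(** The Jones projection is determined by the subalgebra, and the label by the
    coordinates of the projection. *)
Lemma subalgebra_of_label_inj : injective subalgebra_of_label.
Proof.
move=> l l' ll'; apply: label_coords_inj; apply: (@coords_inj (label_proj l)).
  exact: label_proj_coords.
have [_ uniq_l] := coideal_of_jones eps4 hab (label_projP l).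
have [Jl' _] := coideal_of_jones eps4 hab (label_projP l').
rewrite -/(subalgebra_of_label l') -ll' in Jl'.
by rewrite (uniq_l _ Jl'); apply: label_proj_coords.
Qed.

Theorem KD4_lattice :
  [/\ \dim {: K} = 16%N,
      exists V : KD4_label -> {vspace K},
        [/\ injective V,
            forall l,
              \dim (V l) = KD4_dim l /\ jones_projection (V l) (label_proj l)
          & forall I : {vspace K},
              coideal_subalgebra Delta I <->
              [\/ I = <[1 : K]>%VS, I = fullv | exists l, I = V l]]
    & forall I I' : {vspace K},
        coideal_subalgebra Delta I -> coideal_subalgebra Delta I' ->
        exists p p' : K,
          [/\ jones_projection I p, jones_projection I' p'
            & (I <= I')%VS <-> cstar_le p' p]].
Proof.
split; first exact: dim_group_algebra.
  exists subalgebra_of_label; split; first exact: subalgebra_of_label_inj.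
    move=> l; split; last exact: (coideal_of_jones eps4 hab (label_projP l)).
    exact: solution_dim (label_sol l) (label_has_dim l) (label_proj_coords l).
  exact: coideal_classification.
move=> _ _ /coideal_of_projection[p pJ ->] /coideal_of_projection[p' pJ' ->].
exists p, p'; split; [exact: coideal_of_jones | exact: coideal_of_jones |].
rewrite (coideal_of_le eps4 hab pJ pJ'); apply: iff_sym.
by apply: cstar_le_proj; [case: pJ | case: pJ'].
Qed.

End Main.

(** * The lattice of [KD(4)] *)

Section Boundary.
Variables (R : realType) (gT : finGroupType) (a b : gT).
Hypothesis hab : dihedral_generators 4 a b.
Local Notation C := R[i].
Local Notation eps := (epsilon R 4).
Local Notation wave := (@wave C eps gT a b).
Local Notation wave_comb := (@wave_comb C eps gT a b).

Lemma omega_coefE i j : (i < 4)%N -> (j < 4)%N ->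
  (nth [::] (Omega_coef R) i)`_j =
  geval C (nth (gz 0) (nth [::] omega_table i) j).
Proof.
have nuE : geval C (Zneg 1, Zpos 2) = nu R.
  by rewrite /geval /= (zevalN _ 1) /zeval mulrC.
have nuVE : geval C (gconj (Zneg 1, Zpos 2)) = (nu R)^* by rewrite geval_conj nuE.
have five : geval C (gz 5) = 5%:R by rewrite /geval /zeval mulr0 addr0.
by case: i j => [|[|[|[|]]]] // [|[|[|[|]]]] //= _ _; rewrite ?geval1 ?nuE ?nuVE.
Qed.

Lemma Omega_klein_twist : Omega R 4 a b = @klein_twist C gT a b.
Proof.
apply: eq_bigr => i _; apply: eq_bigr => j _.
by rewrite -omega_coefE.
Qed.

Lemma KD_coproductE x : KD_coproduct 4 a b x = @twisted_coproduct C gT a b x.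
Proof. by rewrite /KD_coproduct Omega_klein_twist. Qed.

Lemma e11E j : e11 R 4 a j = wave (j, false).
Proof.
apply: (@wave_la C eps gT a b (fun k => eps ^- (j * k)) j) => k.
by rewrite (eighth_rootV (epsilon4 R)) mulnA.
Qed.

Lemma e21E j : e21 R 4 a b j = wave (j, true).
Proof.
apply: (@wave_lba C eps gT a b (fun k => eps ^- (j * k)) j) => k.
by rewrite (eighth_rootV (epsilon4 R)) mulnA.
Qed.

Lemma expr_neg j k : (j <= 8)%N -> eps ^+ (j * k) = eps ^+ (7 * (8 - j) * k).
Proof.
move=> j8; rewrite -(eighth_root_mod (epsilon4 R)).
rewrite -[RHS](eighth_root_mod (epsilon4 R)).
rewrite -modnMml -[in RHS]modnMml; congr (eps ^+ ((_ * k) %% 8)).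
by do 9?[case: j j8 => [|j] j8 //].
Qed.

Lemma e22E j : (j <= 8)%N -> e22 R 4 a j = wave ((8 - j)%N, false).
Proof.
move=> j8; apply: (@wave_la C eps gT a b (fun k => eps ^+ (j * k)) (8 - j)%N).
by move=> k; apply: expr_neg.
Qed.

Lemma e12E j : (j <= 8)%N -> e12 R 4 a b j = wave ((8 - j)%N, true).
Proof.
move=> j8; apply: (@wave_lba C eps gT a b (fun k => eps ^+ (j * k)) (8 - j)%N).
by move=> k; apply: expr_neg.
Qed.

Lemma e1E : e1 R 4 a b = wave_comb (pauli 0).
Proof. exact: (wave_e1 eps a b). Qed.

Lemma e2E : e2 R 4 a b = wave_comb (pauli 1).
Proof. exact: (wave_e2 eps a b). Qed.

Lemma e3E : e3 R 4 a b = wave_comb (pauli 2).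
Proof. exact: (wave_e3 a b (epsilon4 R)). Qed.

Lemma e4E : e4 R 4 a b = wave_comb (pauli 3).
Proof. exact: (wave_e4 a b (epsilon4 R)). Qed.

Lemma p11E j : (0 < j < 4)%N -> p11 R 4 a b j = wave_comb (p11_comb j).
Proof.
move=> j4; have j8 : (j <= 8)%N by case/andP: j4 => _ /ltnW/leq_trans->.
rewrite /p11 e11E e12E // e21E e22E //.
exact: wave_p11.
Qed.

Lemma p22E j : (0 < j < 4)%N -> p22 R 4 a b j = wave_comb (p22_comb j).
Proof.
move=> j4; have j8 : (j <= 8)%N by case/andP: j4 => _ /ltnW/leq_trans->.
rewrite /p22 e11E e12E // e21E e22E //.
exact: wave_p22.
Qed.

Lemma r11E j : (0 < j < 4)%N -> r11 R 4 a b j = wave_comb (r11_comb j).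
Proof.
move=> j4; have j8 : (j <= 8)%N by case/andP: j4 => _ /ltnW/leq_trans->.
rewrite /r11 e11E e12E // e21E e22E //.
exact: wave_r11.
Qed.

Lemma r22E j : (0 < j < 4)%N -> r22 R 4 a b j = wave_comb (r22_comb j).
Proof.
move=> j4; have j8 : (j <= 8)%N by case/andP: j4 => _ /ltnW/leq_trans->.
rewrite /r22 e11E e12E // e21E e22E //.
exact: wave_r22.
Qed.

Lemma sum_odd_lt4 (V : nmodType) (F : nat -> V) :
  \sum_(1 <= j < 4 | odd j) F j = F 1%N + F 3%N.
Proof. by rewrite /index_iota /= !big_cons big_nil /= addr0. Qed.

Lemma sum_even_lt4 (V : nmodType) (F : nat -> V) :
  \sum_(1 <= j < 4 | ~~ odd j) F j = F 2%N.
Proof. by rewrite /index_iota /= !big_cons big_nil /= addr0. Qed.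

Lemma KD4_projE l : KD4_proj R a b l = @label_proj C eps gT a b l.
Proof.
have p1E : p1 R 4 a b = wave_comb (p11_comb 1 ++ p11_comb 3).
  rewrite /p1 sum_odd_lt4 (p11E (j := 1) isT) (p11E (j := 3) isT).
  exact: esym (wave_comb_cat _ _ _ _ _).
have p2E : p2 R 4 a b = wave_comb (p22_comb 1 ++ p22_comb 3).
  rewrite /p2 sum_odd_lt4 (p22E (j := 1) isT) (p22E (j := 3) isT).
  exact: esym (wave_comb_cat _ _ _ _ _).
have q1E : q1 R 4 a b = wave_comb (p11_comb 2).
  rewrite /q1 sum_even_lt4; exact: p11E.
have q2E : q2 R 4 a b = wave_comb (p22_comb 2).
  rewrite /q2 sum_even_lt4; exact: p22E.
rewrite /label_proj; case: l; rewrite /KD4_proj /proj_comb.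
all: rewrite ?e1E ?e2E ?e3E ?e4E ?p1E ?p2E ?q1E ?q2E.
all: rewrite ?(r11E (j := 1) isT) ?(r11E (j := 2) isT) ?(r11E (j := 3) isT).
all: rewrite ?(r22E (j := 1) isT) ?(r22E (j := 2) isT) ?(r22E (j := 3) isT).
all: rewrite !(@wave_comb_cat C eps gT a b).
all: reflexivity.
Qed.

End Boundary.

Lemma coideal_subalgebra_ext (C : numClosedFieldType) (gT : finGroupType)
    (D D' : group_algebra C gT -> group_algebra C (gT * gT)%type) I :
  D =1 D' -> coideal_subalgebra D I <-> coideal_subalgebra D' I.
Proof.
move=> DD'; split=> -[I1 IM Is ID]; split=> // x xI.
- by rewrite -DD'; apply: ID.
- by rewrite DD'; apply: ID.
Qed.

Theorem proposition7p6 (R : realType) (gT : finGroupType) (a b : gT)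
    (hab : dihedral_generators 4 a b) :
  let K := group_algebra R[i] gT in
  let coideal (I : {vspace K}) := coideal_subalgebra (KD_coproduct 4 a b) I in
  [/\ \dim {: K} = 16%N,
      exists L : KD4_label -> {vspace K},
        [/\ injective L,
            forall l : KD4_label,
              \dim (L l) = KD4_dim l
              /\ jones_projection (L l) (KD4_proj R a b l)
          & forall I : {vspace K},
              coideal I <->
              [\/ I = <[1 : group_algebra R[i] gT]>%VS, I = fullv | exists l : KD4_label, I = L l]]
    & forall I I' : {vspace K},
        coideal I -> coideal I' ->
        exists p p' : K,
          [/\ jones_projection I p,
              jones_projection I' p'
            & (I <= I')%VS <-> cstar_le p' p]].
Proof.
move=> K coideal.
have coidealE I :
    coideal I <-> coideal_subalgebra (@twisted_coproduct R[i] gT a b) I.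
  exact: coideal_subalgebra_ext (@KD_coproductE R gT a b).
have [dimK [V [V_inj V_jones V_all]] V_le] := KD4_lattice (epsilon4 R) hab.
split; [exact: dimK | exists V; split |].
- exact: V_inj.
- by move=> l; rewrite KD4_projE; apply: V_jones.
- move=> I; apply: iff_trans (coidealE I) _; exact: V_all.
- move=> I I' /coidealE cI /coidealE cI'; exact: V_le.
Qed.
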